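(* Let $H$, $V$, $A$, $B$, $P$, $Q$, $R$ be as in the context, let $f\in L^2_{\rm loc}(\mathbb{R},H)$, and suppose that $u\in L^2_{\rm loc}(\mathbb{R},H)$ is a weak solution of $Au'+Pu+Bu+R[u]=f$. Then for any $\eta\in C_0^\infty(\mathbb{R})$, $\eta*u$ is a strong solution (of the equation with right-hand side $\eta*f$), and in fact $$\eta*u\in C^\infty(\mathbb{R},V).$$
   Context: $H$ is a separable real Hilbert space with inner product $\langle\cdot,\cdot\rangle$ and norm $\|\cdot\|$. $V\subset H$ is a dense subspace, itself a separable Hilbert space with norm $\|\cdot\|_V$ defining a stronger topology than that induced by $H$. $\mathcal{B}(H)$ is the space of bounded linear operators on $H$ with the operator norm, and $\mathcal{B}_{\rm symm}(H)$ its subspace of self-adjoint operators. Assumptions: - $A\in\mathcal{B}_{\rm symm}(H)$ with $C_*I\le A\le C^*I$, $0<C_*\le C^*$; - $B\in\mathcal{B}(H)$; - $Q\in L^1(\mathbb{R},\mathcal{B}_{\rm symm}(H))\cap C^0(\mathbb{R}_+,\mathcal{B}(H))$ with $Q(t)=0$ for $t<0$ ($\mathbb{R}_+=[0,\infty)$); - $P$ is a skew-adjoint operator on $H$ with domain $V$, whose graph norm is equivalent to $\|\cdot\|_V$. $L^2_+(\mathbb{R},H)=\{v\in L^2_{\rm loc}(\mathbb{R},H): v\in L^2((-\infty,T],H)\text{ for each }T\in\mathbb{R}\}$. For $u\in L^2_+(\mathbb{R},H)$, $R[u](t)=\int Q(t-s)u(s)\,ds$; the formal adjoint is $R^*[\phi](t)=\int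 Q(s-t)\phi(s)\,ds$. A weak solution of $Au'+Pu+Bu+R[u]=f$ is a $u\in L^2_+(\mathbb{R},H)$ such that for all $\phi\in C_0^\infty(\mathbb{R},V)$, $$\int\langle u(t),(A\phi'+P\phi-B^*\phi-R^*[\phi])(t)\rangle\,dt=-\int\langle f(t),\phi(t)\rangle\,dt .$$ A strong solution is a $u\in C^1(\mathbb{R},H)\cap C^0(\mathbb{R},V)\cap L^2_+(\mathbb{R},H)$ satisfying the equation pointwise in $t$. Convolution in time: $(\eta*u)(t)=\int\eta(t-s)u(s)\,ds$. *)

(* Defs.v *)
From HB Require Import structures.
From mathcomp Require Import all_boot all_order all_algebra.
From mathcomp Require Import all_classical all_reals all_analysis.
From mathcomp Require Import sesquilinear.

Set Implicit Arguments.
Unset Strict Implicit.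
Unset Printing Implicit Defensive.

Import Order.TTheory GRing.Theory Num.Def Num.Theory.
Import numFieldNormedType.Exports.

Local Open Scope classical_set_scope.
Local Open Scope ring_scope.

Section BoundedOperators.
Context {R : realType} (V W : normedModType R).

Definition is_bounded_op : {pred V -> W} := fun f =>
  `[< linear f /\ exists M : R, forall x, `|f x| <= M * `|x| >].

Record bounded_op := BoundedOp {
  bounded_op_fun :> V -> W;
  bounded_opP : bounded_op_fun \in is_bounded_op }.

HB.instance Definition _ := [isSub for bounded_op_fun].
HB.instance Definition _ := [Choice of bounded_op by <:].

Lemma is_bounded_op_submod_closed : submod_closed is_bounded_op.
Proof.
split=> [|a f g]; rewrite !unfold_in.
  apply/asboolP; split; first by move=> k x y; rewrite /= scaler0 addr0.
  by exists 0 => x; rewrite normr0 mul0r.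
move=> /asboolP[lf [M fM]] /asboolP[lg [N gN]]; apply/asboolP; split.
  move=> k x y /=; rewrite /= !fctE.
  change (a *: f (k *: x + y) + g (k *: x + y) =
    k *: (a *: f x + g x) + (a *: f y + g y)).
  by rewrite lf lg !scalerDr !scalerA [k * a]mulrC addrACA.
exists (`|a| * M + N) => x.
change (`|a *: f x + g x| <= (`|a| * M + N) * `|x|).
rewrite (le_trans (ler_normD _ _))// mulrDl lerD// normrZ -mulrA.
by rewrite ler_wpM2l.
Qed.

HB.instance Definition _ :=
  GRing.isSubmodClosed.Build R (V -> W) is_bounded_op
    is_bounded_op_submod_closed.
HB.instance Definition _ := [SubChoice_isSubLmodule of bounded_op by <:].

Definition op_norm (f : bounded_op) : R :=
  sup [set `|f x| | x in [set x : V | `|x| <= 1]].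

Lemma bounded_op_linear (f : bounded_op) : linear f.
Proof. by have := bounded_opP f; rewrite unfold_in => /asboolP[]. Qed.

Lemma bounded_opZ (f : bounded_op) (k : R) x : f (k *: x) = k *: f x.
Proof.
have f0 : f 0 = 0.
  have := bounded_op_linear f (-1) 0 0.
  by rewrite scaler0 addr0 scaleN1r addNr.
by rewrite -[k *: x]addr0 bounded_op_linear f0 addr0.
Qed.

Lemma op_norm_has_sup (f : bounded_op) :
  has_sup [set `|f x| | x in [set x : V | `|x| <= 1]].
Proof.
split; first by exists `|f 0|, 0 => //=; rewrite normr0.
have := bounded_opP f; rewrite unfold_in => /asboolP[_ [M fM]].
exists `|M| => _ [x /= x1 <-]; rewrite (le_trans (fM x))//.
rewrite (le_trans (ler_norm _))// normrM normr_id.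
by rewrite ler_piMr.
Qed.

Lemma op_norm_ub (f : bounded_op) x : `|f x| <= op_norm f * `|x|.
Proof.
have [->|x0] := eqVneq x 0.
  rewrite -[X in f X](scale0r 0) bounded_opZ scale0r !normr0.
  by rewrite mulr0.
have xx : `|x| != 0 by rewrite normr_eq0.
have x_gt0 : 0 < `|x| by rewrite normr_gt0.
rewrite -ler_pdivrMr// mulrC -[X in X * _]ger0_norm ?invr_ge0//.
rewrite -normrZ -bounded_opZ; apply: ub_le_sup.
  by have [] := op_norm_has_sup f.
by exists (`|x|^-1 *: x) => //=; rewrite normrZ normfV normr_id mulVf.
Qed.

Lemma op_norm_le (f : bounded_op) (M : R) :
  0 <= M -> (forall x, `|f x| <= M * `|x|) -> op_norm f <= M.
Proof.
move=> M0 fM; apply: ge_sup; first by have [] := op_norm_has_sup f.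
by move=> _ [x /= x1 <-]; rewrite (le_trans (fM x))// ler_piMr.
Qed.

Lemma op_norm_ge0 (f : bounded_op) : 0 <= op_norm f.
Proof.
apply: (@le_trans _ _ `|f 0|) => //; apply: ub_le_sup.
  by have [] := op_norm_has_sup f.
by exists 0 => //=; rewrite normr0.
Qed.

Lemma op_normD (f g : bounded_op) : op_norm (f + g) <= op_norm f + op_norm g.
Proof.
apply: op_norm_le => [|x]; first by rewrite addr_ge0 ?op_norm_ge0.
change (`|f x + g x| <= (op_norm f + op_norm g) * `|x|).
by rewrite (le_trans (ler_normD _ _))// mulrDl lerD ?op_norm_ub.
Qed.

Lemma op_normZ_le (k : R) (f : bounded_op) :
  op_norm (k *: f) <= `|k| * op_norm f.
Proof.
apply: op_norm_le => [|x]; first by rewrite mulr_ge0 ?op_norm_ge0.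
change (`|k *: f x| <= (`|k| * op_norm f) * `|x|).
by rewrite normrZ -mulrA ler_wpM2l// op_norm_ub.
Qed.

Lemma op_normZ (k : R) (f : bounded_op) : op_norm (k *: f) = `|k| * op_norm f.
Proof.
apply/eqP; rewrite eq_le op_normZ_le/=.
have [->|k0] := eqVneq k 0; first by rewrite normr0 mul0r op_norm_ge0.
rewrite -ler_pdivlMl ?normr_gt0// -normfV.
by have := op_normZ_le k^-1 (k *: f); rewrite scalerA mulVf// scale1r.
Qed.

Lemma op_norm0_eq0 (f : bounded_op) : op_norm f = 0 -> f = 0.
Proof.
move=> f0; apply/val_inj/funext => x /=; apply/eqP.
by rewrite -normr_le0 (le_trans (op_norm_ub f x))// f0 mul0r.
Qed.

HB.instance Definition _ :=
  Lmodule_isNormed.Build R bounded_op op_normD op_normZ op_norm0_eq0.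

End BoundedOperators.

Section BochnerIntegral.
Context {R : realType} {E : normedModType R}.
Local Notation mu := (@lebesgue_measure R).

Definition simple_function (s : R -> E) : Prop :=
  finite_set (range s) /\ forall x, measurable (s @^-1` [set x]).

(* Convergence is everywhere and preimages are Borel, so for separable [E] this
   is Borel measurability: a class modulo null sets is handled through any of
   its Borel representatives, which always exist. *)
Definition strongly_measurable (u : R -> E) : Prop :=
  exists s : nat -> R -> E, (forall n, simple_function (s n)) /\
    forall t, s n t @[n --> \oo] --> u t.

Definition bochner_integrable (u : R -> E) : Prop :=
  strongly_measurable u /\ (\int[mu]_t (`|u t|%:E) < +oo)%E.

Definition simple_integral (s : R -> E) : E :=
  \sum_(x \in range s) fine (mu (s @^-1` [set x])) *: x.

Definition is_bochner_integral (u : R -> E) (w : E) : Prop :=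
  strongly_measurable u /\
  exists s : nat -> R -> E,
    [/\ forall n, simple_function (s n) /\ bochner_integrable (s n),
        (\int[mu]_t (`|u t - s n t|%:E))%E @[n --> \oo] --> 0%E &
        simple_integral (s n) @[n --> \oo] --> w].

Definition bochner_integral (u : R -> E) : E := xget 0 (is_bochner_integral u).

Definition L2loc (u : R -> E) : Prop :=
  strongly_measurable u /\
  forall a b : R, (\int[mu]_(t in `[a, b]) ((`|u t| ^+ 2)%:E) < +oo)%E.

Definition L2plus (u : R -> E) : Prop :=
  L2loc u /\
  forall T : R, (\int[mu]_(t in `]-oo, T]) ((`|u t| ^+ 2)%:E) < +oo)%E.

Definition smooth (u : R -> E) : Prop :=
  forall n t, derivable (derive1n n u) t 1.

Definition compactly_supported (u : R -> E) : Prop :=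
  compact (closure [set t | u t != 0]).

Definition test_function (u : R -> E) : Prop :=
  smooth u /\ compactly_supported u.

Definition C1 (u : R -> E) : Prop :=
  (forall t, derivable u t 1) /\ continuous (derive1 u).

Definition convolution (eta : R -> R) (u : R -> E) (t : R) : E :=
  bochner_integral (fun s => eta (t - s) *: u s).

End BochnerIntegral.

Definition separable (T : topologicalType) : Prop :=
  exists2 D : set T, countable D & dense D.

Section Hilbert.
Context {R : realType} {H : completeNormedModType R}.

Definition induces_norm (ip : {dot H for idfun}) : Prop :=
  forall x, ip x x = `|x| ^+ 2.

Definition self_adjoint (ip : {dot H for idfun}) (T : H -> H) : Prop :=
  forall x y, ip (T x) y = ip x (T y).

Definition adjoint (ip : {dot H for idfun}) (T : H -> H) (y : H) : H :=
  xget 0 [set z | forall x, ip (T x) y = ip x z].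

(* A subspace of [H] carrying its own norm is a type [V] together with its
   inclusion [iota]; an operator [P : V -> H] has domain [range iota]. *)
Context {V : completeNormedModType R} (iota : V -> H).

Definition adjoint_graph (ip : {dot H for idfun}) (P : V -> H) : set (H * H) :=
  [set yz | forall x : V, ip (P x) yz.1 = ip (iota x) yz.2].

Definition skew_adjoint (ip : {dot H for idfun}) (P : V -> H) : Prop :=
  adjoint_graph ip P = [set (iota v, - P v) | v in [set: V]].

Definition graph_norm (P : V -> H) (v : V) : R :=
  Num.sqrt (`|iota v| ^+ 2 + `|P v| ^+ 2).

Definition graph_norm_equivalent (P : V -> H) : Prop :=
  exists c C : R, [/\ 0 < c, 0 < C &
    forall v, c * `|v| <= graph_norm P v <= C * `|v|].

End Hilbert.

Section Equation.
Context {R : realType} {H V : completeNormedModType R}.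
Variables (ip : {dot H for idfun}) (iota : V -> H).
Variables (A : bounded_op H H) (P : V -> H) (B : bounded_op H H).
Variable Q : R -> bounded_op H H.

Definition memory (u : R -> H) (t : R) : H :=
  bochner_integral (fun s => Q (t - s) (u s)).

Definition memory_adjoint (phi : R -> H) (t : R) : H :=
  bochner_integral (fun s => Q (s - t) (phi s)).

Definition weak_solution (f u : R -> H) : Prop :=
  L2plus u /\
  forall phi : R -> V, test_function phi ->
    \int[lebesgue_measure]_t
      ip (u t) (A (iota (derive1 phi t)) + P (phi t)
                - adjoint ip B (iota (phi t))
                - memory_adjoint (iota \o phi) t)
    = - \int[lebesgue_measure]_t ip (f t) (iota (phi t)).

(* For [u] in [L2plus], [s |-> Q (t - s) (u s)] is in general integrable only
   for almost every [t]; the pointwise equation includes its integrability for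
   every [t], so that [memory u t] is never the default value. *)
Definition strong_solution (f u : R -> H) : Prop :=
  [/\ C1 u, L2plus u &
    exists v : R -> V, [/\ continuous v, forall t, iota (v t) = u t &
      forall t, bochner_integrable (fun s => Q (t - s) (u s)) /\
        A (derive1 u t) + P (v t) + B (u t) + memory u t = f t]].

End Equation.

(* Main.v *)
(* Testing the weak equation against [t |-> eta (tau - t) v] and moving the
   integrals onto [u] (by Fubini for the memory term) gives
     <eta*u, P v> = <A (eta'*u) + B (eta*u) + R[eta*u] - eta*f, v>  for v in V.
   Since P is skew-adjoint this says that (eta*u)(tau) lies in V, with P (eta*u)
   equal to the opposite of the bracket: the equation holds pointwise.
   For smoothness in V, Taylor's formula for eta bounds
   F (t + h) - F t - h F' t by K h^2 both for F = eta*u and for the bracket, whose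
   derivatives are obtained by replacing eta with eta'.  Hence the same bound
   holds in the graph norm, so the derivative in V of the lift of eta*u is the
   lift of eta'*u, and one iterates. *)

Require Import Defs.
From HB Require Import structures.
From mathcomp Require Import all_boot all_order all_algebra.
From mathcomp Require Import finmap.
From mathcomp Require Import all_classical all_reals all_analysis.
From mathcomp Require Import sesquilinear measurable_realfun.
From mathcomp Require Import ring lra.

Set Implicit Arguments.
Unset Strict Implicit.
Unset Printing Implicit Defensive.

Import Order.TTheory GRing.Theory Num.Def Num.Theory.
Import numFieldNormedType.Exports.

Local Open Scope classical_set_scope.
Local Open Scope ring_scope.

(** * Limits of simple maps *)

(** Integrals in [H] are given by a choice operator, so they are reached only through scalar
    pairings: the integral of [u] is the one vector [w] for which [ip w v] is the integral of
    [ip (u t) v] for every [v]. Linearity, norm bounds and Fubini are then inherited from real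
    integrals. The obstacle is that [u] is controlled on half-lines []-oo, T]] only, while the
    memory term involves the whole past. Estimates on [eta*u] are therefore made uniform over
    [t <= T], and causality of [Q] ensures that the memory at time [t] sees no later time. A uniform
    second-order bound, unlike differentiability at each point, passes through the integral against
    [Q] at the cost of a factor, the L1 norm of [Q]. The term [eta*f] is not integrated over the
    past, so a bound depending on [t] is enough for it. Nothing is differentiated inside [V]
    beforehand: the lift of [eta*u] is chosen point by point, and the bounds in [H] on the two
    components of the graph of [P] are what control its increments. *)

Section SimpleMaps.
Context d (T : measurableType d).

Definition simple_map (E : Type) (s : T -> E) : Prop :=
  finite_set (range s) /\ forall x, measurable (s @^-1` [set x]).

(** Finitely many fibres make up the preimage, so [A] is arbitrary and [E] needs no
    sigma-algebra. *)
Lemma simple_map_preimage (E : Type) (s : T -> E) (A : set E) :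
  simple_map s -> measurable (s @^-1` A).
Proof.
move=> [fs ms].
have -> : s @^-1` A = \bigcup_(x in range s `&` A) (s @^-1` [set x]).
  apply/seteqP; split => [t At|t [x [_ Ax] /= ->]//].
  by exists (s t) => //; split => //; exists t.
apply: fin_bigcup_measurable => [|x _]; last exact: ms.
exact: finite_setIl.
Qed.

Lemma simple_map_comp (E F : Type) (h : E -> F) (s : T -> E) :
  simple_map s -> simple_map (h \o s).
Proof.
move=> ss; split; last by move=> y; exact: (simple_map_preimage (h @^-1` [set y])).
case: ss => fs _; rewrite -(image_comp s h); exact: finite_image.
Qed.

Lemma simple_map_pair (E F : Type) (s : T -> E) (r : T -> F) :
  simple_map s -> simple_map r -> simple_map (fun t => (s t, r t)).
Proof.
move=> [fs ms] [fr mr]; split.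
  apply: (@sub_finite_set _ _ (range s `*` range r)).
    by move=> _ [t _ <-] /=; split; exists t.
  exact: finite_setX.
move=> [x y].
have -> : (fun t => (s t, r t)) @^-1` [set (x, y)] =
    s @^-1` [set x] `&` r @^-1` [set y].
  by apply/seteqP; split => [t [<- <-]//|t [/= -> ->]].
exact: measurableI.
Qed.

(* [strongly_measurable] over an arbitrary measurable domain; the product domain
   gives the joint measurability that Fubini's theorem requires. *)
Definition simple_limit (E : topologicalType) (u : T -> E) : Prop :=
  exists s : nat -> T -> E, (forall n, simple_map (s n)) /\
    forall t, s n t @[n --> \oo] --> u t.

Lemma simple_limit_map (E F : topologicalType) (h : E -> F) (u : T -> E) :
  continuous h -> simple_limit u -> simple_limit (h \o u).
Proof.
move=> ch [s [ss su]]; exists (fun n => h \o s n); split.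
  by move=> n; exact: simple_map_comp.
by move=> t /=; apply: continuous_cvg; [exact: ch|exact: su].
Qed.

Lemma simple_limit_map2 (E F G : topologicalType) (h : E * F -> G)
    (u : T -> E) (v : T -> F) :
  continuous h -> simple_limit u -> simple_limit v ->
  simple_limit (fun t => h (u t, v t)).
Proof.
move=> ch [s [ss su]] [r [sr rv]].
exists (fun n t => h (s n t, r n t)); split.
  by move=> n; exact: (simple_map_comp h (simple_map_pair (ss n) (sr n))).
move=> t; apply: (@cvg_comp _ _ _ (fun n => (s n t, r n t)) h).
  exact: (cvg_pair (su t) (rv t)).
exact: ch.
Qed.

Lemma simple_limit_cst (E : topologicalType) (x : E) :
  simple_limit (fun=> x : E).
Proof.
exists (fun _ _ => x); split; last by move=> t; exact: cvg_cst.
move=> _; split; last by move=> y; rewrite preimage_cst; case: ifP.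
by apply: (@sub_finite_set _ _ [set x]) => // _ [t _ <-].
Qed.

Lemma simple_limit_measurable (R : realType) (u : T -> R) :
  simple_limit (u : T -> R^o) -> measurable_fun setT u.
Proof.
move=> [s [ss su]]; apply: (measurable_fun_cvg (h := s)) => [n|t _]; last exact: su.
by move=> _ A mA; rewrite setTI; exact: simple_map_preimage.
Qed.

Import HBSimple.

Lemma measurable_simple_limit (R : realType) (u : T -> R) :
  measurable_fun setT u -> simple_limit (u : T -> R^o).
Proof.
move=> mu.
have [g gu] := approximation_sfun measurableT ((measurable_EFinP _ _).2 mu).
exists (fun n => g n : T -> R^o); split.
  move=> n; split; first exact: fimfunP.
  by move=> x; rewrite -[X in measurable X]setTI; exact: (measurable_funP (g n)).
by move=> t; have /fine_cvgP[] := gu t I.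
Qed.

End SimpleMaps.

Lemma simple_limit_precomp d d' (T : measurableType d) (T' : measurableType d')
    (E : topologicalType) (g : T' -> T) (u : T -> E) :
  measurable_fun setT g -> simple_limit u -> simple_limit (u \o g).
Proof.
move=> mg [s [ss su]]; exists (fun n => s n \o g); split; last first.
  by move=> t; exact: su.
move=> n; have [fs ms] := ss n; split.
  by apply: sub_finite_set fs => _ [t _ <-]; exists (g t).
move=> x; rewrite comp_preimage -[X in measurable X]setTI.
exact/mg/ms.
Qed.

Section StronglyMeasurable.
Context {R : realType}.

Lemma strongly_measurableE (E : normedModType R) (u : R -> E) :
  strongly_measurable u = simple_limit (u : measurableTypeR R -> E).
Proof. by []. Qed.

(** The identity of [R] is a limit of simple maps, and composing with [u] preserves such limits. *)
Lemma strongly_measurable_continuous (E : normedModType R) (u : R -> E) :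
  continuous u -> strongly_measurable u.
Proof.
move=> cu; rewrite strongly_measurableE.
have : simple_limit (idfun : measurableTypeR R -> R^o).
  by apply: measurable_simple_limit; exact: measurable_id.
exact: simple_limit_map.
Qed.

Lemma strongly_measurable_norm (E : normedModType R) (u : R -> E) :
  strongly_measurable u -> measurable_fun setT (fun t => `|u t|).
Proof.
rewrite strongly_measurableE => su; apply: simple_limit_measurable.
apply: (simple_limit_map (h := (fun x : E => `|x| : R^o)) _ su).
exact: norm_continuous.
Qed.

(** Joint continuity of evaluation makes [s |-> Q (t - s) (U s)] strongly measurable. It follows
    from [q x - a b = q (x - b) + (q - a) b], where [b] stays bounded by [|x| + 1]. *)
Lemma continuous_apply (E F : normedModType R) :
  continuous (fun z : bounded_op E F * E => z.1 z.2).
Proof.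
move=> [q x]; apply/cvgrPdist_lt => e e0 /=.
pose M := `|x| + 1; have M0 : 0 < M by rewrite ltr_pwDr.
pose N := `|q| + 1; have N0 : 0 < N by rewrite ltr_pwDr.
have : \forall z \near (q, x),
    `|q - z.1| < e / 2 / M /\ `|x - z.2| < minr 1 (e / 2 / N).
  have [d d0 [d1 d2]] : exists2 d : R, 0 < d &
      d <= e / 2 / M /\ d <= minr 1 (e / 2 / N).
    exists (minr (e / 2 / M) (minr 1 (e / 2 / N))).
      by rewrite !lt_min !divr_gt0 ?ltr01.
    by split; rewrite ge_min lexx ?orbT.
  exists (ball q d, ball x d); first by split; exact: nbhsx_ballx.
  move=> [a b] /=; rewrite -!ball_normE /= => -[a1 a2].
  by split; [exact: lt_le_trans a1 _|exact: lt_le_trans a2 _].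
apply: filterS => -[a b] /= [qa]; rewrite lt_min => /andP[xb1 xb].
have -> : q x - a b = q (x - b) + (q - a) b.
  have -> : q (x - b) = q x - q b.
    by rewrite addrC -scaleN1r bounded_op_linear scaleN1r addrC.
  by change (q x - a b = q x - q b + (q b - a b)); rewrite addrA subrK.
have bM : `|b| <= M.
  rewrite -(subrK x b) addrC (le_trans (ler_normD _ _))// lerD2l.
  by rewrite distrC ltW.
rewrite (le_lt_trans (ler_normD _ _))// (splitr e) ltr_leD//.
  rewrite (le_lt_trans (op_norm_ub _ _))//.
  rewrite (@le_lt_trans _ _ (N * `|x - b|))//.
    by rewrite ler_wpM2r// lerDl.
  by rewrite mulrC -ltr_pdivlMr.
rewrite (le_trans (op_norm_ub _ _))//.
rewrite (@le_trans _ _ (op_norm (q - a) * M))//.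
  by rewrite ler_wpM2l// op_norm_ge0.
by rewrite -ler_pdivlMr// ltW.
Qed.

End StronglyMeasurable.

(** * Inner products and the Riesz representation *)

Section InnerProduct.
Context {R : realType} {H : completeNormedModType R} (ip : {dot H for idfun}).
Hypothesis ip_norm : induces_norm ip.

Lemma ipC x y : ip x y = ip y x.
Proof. by rewrite hermC expr0 mul1r. Qed.

Lemma ipDl x y z : ip (x + y) z = ip x z + ip y z.
Proof. exact: linearDl. Qed.

Lemma ipZl k x z : ip (k *: x) z = k * ip x z.
Proof. exact: linearZl_LR. Qed.

Lemma ip0l z : ip 0 z = 0.
Proof. exact: linear0l. Qed.

Lemma ipNl x z : ip (- x) z = - ip x z.
Proof. by rewrite -scaleN1r ipZl mulN1r. Qed.

Lemma ipBl x y z : ip (x - y) z = ip x z - ip y z.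
Proof. by rewrite ipDl ipNl. Qed.

Lemma ipDr x y z : ip z (x + y) = ip z x + ip z y.
Proof. by rewrite ipC ipDl !(ipC z). Qed.

Lemma ipZr k x z : ip z (k *: x) = k * ip z x.
Proof. by rewrite ipC ipZl ipC. Qed.

Lemma ipNr x z : ip z (- x) = - ip z x.
Proof. by rewrite ipC ipNl ipC. Qed.

Lemma ipBr x y z : ip z (x - y) = ip z x - ip z y.
Proof. by rewrite ipDr ipNr. Qed.

Lemma ip_cauchy_schwarz x y : `|ip x y| <= `|x| * `|y|.
Proof.
have [->|y0] := eqVneq y 0; first by rewrite ipC ip0l !normr0 mulr0.
have yy : 0 < `|y| ^+ 2 by rewrite exprn_gt0 ?normr_gt0.
rewrite -(@ler_pXn2r _ 2) ?nnegrE ?mulr_ge0// exprMn real_normK ?num_real//.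
(* [w] is [|y|^2] times the component of [x] orthogonal to [y]; the factor avoids a division. *)
pose w := (`|y| ^+ 2) *: x - ip x y *: y.
have : 0 <= ip w w by rewrite ip_norm exprn_ge0.
rewrite /w !ipBl !ipZl !ipBr !ipZr !ip_norm (ipC y x).
set a := ip x y; set b := `|x|; set c := `|y| ^+ 2 => h.
have : 0 <= c * (b ^+ 2 * c - a ^+ 2) by nra.
by rewrite pmulr_rge0// subr_ge0.
Qed.

Lemma ip_ext x y : (forall z, ip x z = ip y z) -> x = y.
Proof.
move=> xy; apply/eqP; rewrite -subr_eq0 -normr_eq0 -sqrf_eq0 -ip_norm.
by rewrite {1}ipBl xy subrr.
Qed.

(** The closing algebra of the tested weak equation: [p] and [q] are the [A] and [B] terms before
    their operators are moved back onto [u]. *)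
Lemma ip_balance (a b c d y : H) (r p q : R) :
  ip a y = p -> ip b y = q -> r - p - q - ip c y = - ip d y ->
  r = ip (a + b + c - d) y.
Proof.
by move=> <- <- h; rewrite ipBl !ipDl -h; ring.
Qed.

Lemma ip_continuous y : continuous (fun x => ip x y : R^o).
Proof.
move=> x; apply/cvgrPdist_lt => e e0 /=.
have y0 : 0 < `|y| + 1 by rewrite ltr_pwDr.
near=> z; rewrite -ipBl (le_lt_trans (ip_cauchy_schwarz _ _))//.
rewrite (@le_lt_trans _ _ (`|x - z| * (`|y| + 1)))//.
  by rewrite ler_wpM2l// lerDl.
rewrite -ltr_pdivlMr//; near: z.
by apply: cvgr_dist_lt; [exact: cvg_id|rewrite divr_gt0].
Unshelve. all: by end_near. Qed.

(* The representer minimizes [|z|^2 - 2 L z]; minimizing sequences are Cauchy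
   by the parallelogram law. *)
Lemma riesz_representation (L : H -> R) (M : R) :
  (forall k x y, L (k *: x + y) = k * L x + L y) ->
  (forall x, `|L x| <= M * `|x|) ->
  exists z, forall x, L x = ip x z.
Proof.
move=> lL bL.
have L0 : L 0 = 0 by apply/eqP; rewrite -normr_le0 (le_trans (bL 0))// normr0 mulr0.
have LZ k x : L (k *: x) = k * L x by rewrite -[k *: x]addr0 lL L0 addr0.
have LD x y : L (x + y) = L x + L y by rewrite -[x in LHS]scale1r lL mul1r.
pose J z : R := `|z| ^+ 2 - 2 * L z.
(* [J z >= |z|^2 - 2 M |z| = (|z| - M)^2 - M^2]. *)
have J_lb z : - M ^+ 2 <= J z.
  have := bL z; have := ler_norm (L z); rewrite /J => h1 h2.
  have := sqr_ge0 (`|z| - M) => h3; nra.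
pose m := inf (range J).
have hinf : has_inf (range J).
  by split; [exists (J 0), 0|exists (- M ^+ 2) => _ [z _ <-]].
have mJ z : m <= J z by apply: ge_inf; [case: hinf|exists z].
have ex n : exists z, J z < m + n.+1%:R^-1.
  have [_ [z _ <-] h] : exists2 x, range J x & x < m + n.+1%:R^-1.
    by apply: inf_adherent => //; rewrite invr_gt0.
  by exists z.
clearbody m; have [z_ hz] := choice ex.
have aux (k a b c d e : R) : k * 4 <= a + b + (b + c) - 4 * (d + e) ->
    a - b + (- b - - c) + 4 * k <= 2 * (a - 2 * d) + 2 * (c - 2 * e).
  by move=> h; lra.
have aux2 (k a b c d f x : R) : c * 4 < f -> d * 4 < f -> a < k + c ->
    b < k + d -> x + 4 * k <= 2 * b + 2 * a -> x < f.
  by move=> *; lra.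
have par x y : `|x - y| ^+ 2 + 4 * m <= 2 * J x + 2 * J y.
  have := mJ (2^-1 *: (x + y)).
  rewrite /J LZ LD normrZ exprMn -!ip_norm !ipDl !ipBr !ipDr !ipNl (ipC y x).
  rewrite ger0_norm ?invr_ge0//.
  rewrite [X in m <= X](_ : _ =
    (ip x x + ip x y + (ip x y + ip y y) - 4 * (L x + L y)) / 4); last by field.
  rewrite ler_pdivlMr//; exact: aux.
have zc : cvgn z_.
  apply/cauchy_cvgP/cauchyP => e e0.
  (* If [J x] and [J y] are within [e^2 / 4] of [m], then [par] gives [|x - y|^2 < e^2]. *)
  have e2 : 0 < e ^+ 2 / 4 by rewrite divr_gt0// exprn_gt0.
  have [N _ hN] := near_infty_natSinv_lt (PosNum e2).
  exists (z_ N); exists N => // n /= Nn.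
  rewrite -ball_normE /= -(@ltr_pXn2r _ 2) ?nnegrE ?normr_ge0 ?(ltW e0)//.
  have := par (z_ N) (z_ n).
  have := hz N; have := hz n; have := hN N (leqnn N); have := hN n Nn => /=.
  rewrite !ltr_pdivlMr// => h1 h2 h3 h4 h5.
  by apply: (aux2 m _ _ _ _ _ (`|z_ N - z_ n| ^+ 2) h1 h2 h3 h4 h5).
set z := limn z_.
have Jz : J z <= m.
  have JC : J (z_ n) @[n --> \oo] --> J z.
    apply: cvgB.
      rewrite expr2; under eq_fun do rewrite expr2.
      by apply: cvgM; apply: cvg_norm.
    apply: (@cvgMl_tmp R _ _ _ (fun n => L (z_ n)) 2 (L z)).
    apply/cvgrPdist_lt => e e0.
    have M1 : 0 < `|M| + 1 by rewrite ltr_pwDr.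
    near=> n.
    have -> : L z - L (z_ n) = L (z - z_ n).
      by rewrite (_ : z - z_ n = (-1) *: z_ n + z) ?lL ?scaleN1r 1?addrC// mulN1r addrC.
    rewrite (le_lt_trans (bL _))// (@le_lt_trans _ _ ((`|M| + 1) * `|z - z_ n|))//.
      by rewrite ler_wpM2r// (le_trans (ler_norm M))// lerDl.
    rewrite mulrC -ltr_pdivlMr//; near: n.
    by apply: cvgr_dist_lt; [exact: zc|rewrite divr_gt0].
  have mc : m + n.+1%:R^-1 @[n --> \oo] --> m.
    rewrite -[X in _ --> X]addr0; apply: cvgD; first exact: cvg_cst.
    exact: cvg_harmonic.
  apply: (ler_cvg_to JC mc); apply: nearW => n; exact/ltW/hz.
exists z => x.
(* Minimality of [z] along the line [z + t x]. With [a = ip x z - L x], the choice [t = - a / |x|^2]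
   turns the right-hand side into [- a^2 / |x|^2], which forces [a = 0]; when [|x|] is zero,
   [t = - a] does. *)
have quad t : 0 <= 2 * t * (ip x z - L x) + t ^+ 2 * `|x| ^+ 2.
  have := le_trans Jz (mJ (t *: x + z)).
  rewrite /J lL -!ip_norm !ipDl !ipDr !ipZl !ipZr (ipC z x) => h; nra.
apply/eqP; rewrite eq_sym -subr_eq0; set a := ip x z - L x in quad *.
have [x0|x0] := eqVneq (`|x| ^+ 2) 0.
  by have := quad (- a); rewrite x0 => h; rewrite -sqrf_eq0 eq_le sqr_ge0 andbT; nra.
have x1 : `|x| != 0 by rewrite -sqrf_eq0.
have xx : 0 < `|x| ^+ 2 by rewrite lt0r x0 exprn_ge0.
have := quad (- (a / `|x| ^+ 2)).
rewrite -sqrf_eq0 eq_le sqr_ge0 andbT.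
have -> : 2 * - (a / `|x| ^+ 2) * a + (- (a / `|x| ^+ 2)) ^+ 2 * `|x| ^+ 2
   = - (a ^+ 2 / `|x| ^+ 2) by field.
by rewrite oppr_ge0 pmulr_lle0 ?invr_gt0.
Unshelve. all: by end_near. Qed.

Lemma adjointP (T : bounded_op H H) x y : ip (T x) y = ip x (adjoint ip T y).
Proof.
have [z hz] : exists z, forall x, ip (T x) y = ip x z.
  apply: (riesz_representation (M := op_norm T * `|y|)) => [k a b|a].
    by rewrite bounded_op_linear ipDl ipZl.
  rewrite (le_trans (ip_cauchy_schwarz _ _))// mulrAC ler_wpM2r//.
  exact: op_norm_ub.
exact: (@xgetPex _ 0 [set z | forall x, ip (T x) y = ip x z]
  (ex_intro _ z hz)).
Qed.

End InnerProduct.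

(** * Derivatives obtained from second-order bounds *)

Section QuadraticRemainder.
Context {R : realType} {E : normedModType R}.

(** Division by [h] leaves an error of size [K |h|]. Derivatives of convolutions, of reflected test
    functions and of lifts to [V] all come from this criterion, which replaces differentiation under
    the integral sign. *)
Lemma quadratic_remainder_derive (F : R -> E) (t : R) (D : E) (K : R) :
  (forall h, `|h| <= 1 -> `|F (t + h) - F t - h *: D| <= K * h ^+ 2) ->
  is_derive t 1 F D.
Proof.
move=> FK.
have lim : h^-1 *: (F (h *: 1 + t) - F t) @[h --> 0^'] --> D.
  apply/cvgrPdist_lt => e e0.
  pose K1 := `|K| + 1; have K0 : 0 < K1 by rewrite ltr_pwDr.
  near=> h.
  have h0 : h != 0 by near: h; exact: nbhs_dnbhs_neq.
  have h1 : `|h| <= 1.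
    by near: h; apply: dnbhs0_le.
  have h2 : `|h| < e / K1.
    by near: h; apply: dnbhs0_lt; rewrite divr_gt0.
  have -> : D - h^-1 *: (F (h *: 1 + t) - F t) =
      (- h^-1) *: (F (t + h) - F t - h *: D).
    rewrite [h *: 1]mulr1 [h + t]addrC [RHS]scalerBr scalerA mulNr mulVf//.
    by rewrite scaleN1r scaleNr opprK [LHS]addrC.
  rewrite normrZ normrN normfV.
  rewrite mulrC ltr_pdivrMr ?normr_gt0// (le_lt_trans (FK _ h1))//.
  rewrite -[h ^+ 2]ger0_norm ?sqr_ge0// normrX expr2 mulrA.
  rewrite ltr_pM2r ?normr_gt0// (@le_lt_trans _ _ (K1 * `|h|))//.
    by rewrite ler_wpM2r// (le_trans (ler_norm K))// lerDl.
  by rewrite mulrC -ltr_pdivlMr.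
split; first by apply/cvg_ex; exists D.
exact/cvg_lim.
Unshelve. all: by end_near. Qed.

Lemma is_derive_derive1 (F : R -> E) (t : R) (D : E) :
  is_derive t 1 F D -> derive1 F t = D.
Proof. by move=> [_ FD]; rewrite derive1E. Qed.

Lemma derivable_continuous (F : R -> E) :
  (forall t, derivable F t 1) -> continuous F.
Proof.
move=> dF t; apply: differentiable_continuous; exact/derivable1_diffP.
Qed.

End QuadraticRemainder.

(** * Scalar test functions and their Taylor remainder *)

Section TestFunctions.
Context {R : realType}.
Implicit Type eta : R -> R^o.

Lemma smooth_derive1 (E : normedModType R) (F : R -> E) :
  smooth F -> smooth (derive1 F).
Proof. by move=> sF n t; have := sF n.+1 t; rewrite derive1Sn. Qed.

Lemma smooth_continuous (E : normedModType R) (F : R -> E) :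
  smooth F -> continuous F.
Proof. by move=> sF; apply: derivable_continuous; exact: sF 0%N. Qed.

Lemma test_function_vanish eta : test_function eta ->
  exists c : R, 0 < c /\ forall t, c < `|t| -> eta t = 0.
Proof.
move=> [_ /compact_bounded [M [_ hM]]].
exists (`|M| + 1); split; first by rewrite ltr_pwDr.
move=> t ct; apply/eqP; apply: contraTT ct => et; rewrite -leNgt.
apply: (hM (`|M| + 1)) => /=; first by rewrite (le_lt_trans (ler_norm M))// ltrDl.
exact: subset_closure.
Qed.

(** The condition [c < |t|] is open, so [eta] vanishes on a neighbourhood of [t]. *)
Lemma derive1_vanish eta (c : R) :
  (forall t, c < `|t| -> eta t = 0) -> forall t, c < `|t| -> derive1 eta t = 0.
Proof.
move=> e0 t ct; apply: is_derive_derive1.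
have near0 : \forall s \near t, eta s = 0.
  have : \forall s \near t, c < `|s|.
    by apply: (@cvgr_gt R R (nbhs t) _ (fun s : R => `|s|) `|t| _ c ct);
      exact: norm_continuous.
  by apply: filterS => s; exact: e0.
apply: (near_eq_is_derive (f := cst 0)).
by apply: filterS near0 => s ->.
Qed.

Lemma test_function_derive1 eta : test_function eta -> test_function (derive1 eta).
Proof.
move=> te; have [c [c0 ce]] := test_function_vanish te.
split; first by apply: smooth_derive1; case: te.
apply: (@subclosed_compact _ _ `[-c, c]); first exact: closed_closure.
  exact: segment_compact.
rewrite [X in _ `<=` X](closure_id _).1; last exact: interval_closed.
apply: closure_subset => t /= et.
rewrite in_itv /= -ler_norml leNgt; apply: contraNN et => ct.
by rewrite (derive1_vanish ce).
Qed.

Lemma test_function_bounded eta : test_function eta ->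
  exists M : R, 0 < M /\ forall t, `|eta t| <= M.
Proof.
move=> te; have [c [c0 ce]] := test_function_vanish te.
have ceta : continuous (fun t => `|eta t|).
  move=> t; apply: cvg_norm; apply: smooth_continuous; by case: te.
have cc : (- c <= c)%R by rewrite ge0_cp// ltW.
have [x _ hx] := @EVT_max _ (fun t => `|eta t|) _ _ cc (continuous_subspaceT ceta).
exists (`|eta x| + 1); split; first by rewrite ltr_pwDr.
move=> t; have [tc|ct] := leP `|t| c; last by rewrite ce// normr0 addr_ge0.
by rewrite (le_trans (hx t _))// ?lerDl// in_itv /= -ler_norml.
Qed.

(** The order of [a] and [b] is free, so that increments [h] of either sign are covered; the Taylor
    estimate needs only the distance of [c] to [a]. *)
Lemma mean_value (F : R -> R^o) : (forall t, derivable F t 1) ->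
  forall a b, exists2 c, `|c - a| <= `|b - a| & F b - F a = derive1 F c * (b - a).
Proof.
move=> dF.
have key a b : a <= b ->
    exists2 c, a <= c <= b & F b - F a = derive1 F c * (b - a).
  move=> ab; have [|c|c cab ->] := @MVT_segment _ F (derive1 F) a b ab.
  - by move=> x _; split; [exact: dF|rewrite derive1E].
  - exact/continuous_subspaceT/derivable_continuous.
  - by exists c => //; move: cab; rewrite in_itv.
move=> a b; have [ab|/ltW ba] := leP a b.
  have [c /andP[ac cb] ->] := key _ _ ab; exists c => //.
  by rewrite !ger0_norm ?subr_ge0// lerD2r.
have [c /andP[bc ca] e] := key _ _ ba; exists c.
  by rewrite !ler0_norm ?subr_le0// lerN2 lerD2r.
by rewrite -opprB e -mulrN opprB.
Qed.

(** Two uses of the mean value theorem write the remainder as [h (c - t) eta''(d)] with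
    [|c - t| <= |h|]; [M] bounds [eta''], uniformly in [t] and [h]. *)
Lemma test_function_remainder eta : test_function eta ->
  exists M : R, 0 < M /\
    forall t h, `|eta (t + h) - eta t - h * derive1 eta t| <= M * h ^+ 2.
Proof.
move=> te; have te1 := test_function_derive1 te.
have [M [M0 M2]] := test_function_bounded (test_function_derive1 te1).
exists M; split => // t h.
have [c] := mean_value (te.1 0%N) t (t + h).
rewrite (addrC t h) addrK => ch ->.
have [d _ e] := mean_value (te1.1 0%N) t c.
rewrite mulrC -mulrBr e !normrM -[h ^+ 2]ger0_norm ?sqr_ge0// normrX expr2.
rewrite [M * _]mulrCA; apply: ler_wpM2l => //.
by apply: ler_pM.
Qed.

End TestFunctions.

(** * Bochner integrals in a Hilbert space *)

Section RealIntegrals.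
Context d (T : measurableType d) (R : realType).
Variable mu : {measure set T -> \bar R}.
Implicit Types F G : T -> R.

Lemma integrable_le F G : measurable_fun setT F ->
  mu.-integrable setT (EFin \o G) -> (forall t, `|F t| <= G t) ->
  mu.-integrable setT (EFin \o F).
Proof.
move=> mF iG FG; apply: (le_integrable measurableT _ _ iG).
  exact/measurable_EFinP.
by move=> t _ /=; rewrite lee_fin (le_trans (FG t))// ler_norm.
Qed.

Lemma integrable_lty F : measurable_fun setT F -> (forall t, 0 <= F t) ->
  (\int[mu]_t (F t)%:E < +oo)%E -> mu.-integrable setT (EFin \o F).
Proof.
move=> mF F0 Fy; apply/integrableP; split; first exact/measurable_EFinP.
rewrite (eq_integral (fun t => (F t)%:E))// => t _.
by rewrite /= ger0_norm.
Qed.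

Lemma integrableZ F k : mu.-integrable setT (EFin \o F) ->
  mu.-integrable setT (EFin \o (fun t => k * F t)).
Proof. by move=> iF; exact: (integrableZl measurableT k iF). Qed.

Lemma integrable_add F G : mu.-integrable setT (EFin \o F) ->
  mu.-integrable setT (EFin \o G) ->
  mu.-integrable setT (EFin \o (fun t => F t + G t)).
Proof. by move=> iF iG; exact: (integrableD measurableT iF iG). Qed.

Lemma integrable_sub F G : mu.-integrable setT (EFin \o F) ->
  mu.-integrable setT (EFin \o G) ->
  mu.-integrable setT (EFin \o (fun t => F t - G t)).
Proof. by move=> iF iG; exact: (integrableB measurableT iF iG). Qed.

Lemma Rintegral_sum (I : Type) (s : seq I) (F : I -> T -> R) :
  (forall i, mu.-integrable setT (EFin \o F i)) ->
  mu.-integrable setT (EFin \o (fun t => \sum_(i <- s) F i t)) /\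
  \int[mu]_t (\sum_(i <- s) F i t) = \sum_(i <- s) \int[mu]_t F i t.
Proof.
move=> iF; elim: s => [|i s [ih1 ih2]].
  rewrite big_nil; split.
    have -> : EFin \o (fun t => \sum_(i <- [::]) F i t) = cst 0%E.
      by apply/funext => t /=; rewrite big_nil.
    exact: integrable0.
  under eq_Rintegral do rewrite big_nil.
  by rewrite Rintegral_cst// mul0r.
have -> : (fun t => \sum_(j <- i :: s) F j t) =
    (fun t => F i t + \sum_(j <- s) F j t).
  by apply/funext => t; rewrite big_cons.
split; last by rewrite RintegralD// big_cons ih2.
exact: integrable_add.
Qed.

(** The four functions stand for the [P], [A], [B] and memory terms of the weak equation; each value
    comes with the integrability that allows the splitting. *)
Lemma Rintegral_sub4 F1 F2 F3 F4 (x1 x2 x3 x4 : R) :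
  mu.-integrable setT (EFin \o F1) /\ \int[mu]_t F1 t = x1 ->
  mu.-integrable setT (EFin \o F2) /\ \int[mu]_t F2 t = x2 ->
  mu.-integrable setT (EFin \o F3) /\ \int[mu]_t F3 t = x3 ->
  mu.-integrable setT (EFin \o F4) /\ \int[mu]_t F4 t = x4 ->
  \int[mu]_t (F1 t - F2 t - F3 t - F4 t) = x1 - x2 - x3 - x4.
Proof.
move=> [i1 <-] [i2 <-] [i3 <-] [i4 <-].
have i12 := integrable_sub i1 i2; have i123 := integrable_sub i12 i3.
by rewrite RintegralB// RintegralB// RintegralB.
Qed.

End RealIntegrals.

Section Bochner.
Context {R : realType} {H : completeNormedModType R} (ip : {dot H for idfun}).
Hypothesis ip_norm : induces_norm ip.
Local Notation mu := (@lebesgue_measure R).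
Implicit Types u s : R -> H.

Lemma bochner_norm_integrable (E : normedModType R) (u : R -> E) :
  bochner_integrable u -> mu.-integrable setT (EFin \o (fun t => `|u t|)).
Proof.
move=> [su uy]; apply: integrable_lty => //.
exact: strongly_measurable_norm.
Qed.

Lemma bochner_integrable_le (E : normedModType R) (u : R -> E) (g : R -> R) :
  strongly_measurable u -> mu.-integrable setT (EFin \o g) ->
  (forall t, `|u t| <= g t) -> bochner_integrable u.
Proof.
move=> su ig ug; split => //.
have : mu.-integrable setT (EFin \o (fun t => `|u t|)).
  apply: (integrable_le _ ig); first exact: strongly_measurable_norm.
  by move=> t; rewrite normr_id.
move=> /integrableP[_]; congr (_ < _)%E.
by apply: eq_integral => t _; rewrite /= normr_id.
Qed.

Lemma strongly_measurable_ip u v :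
  strongly_measurable u -> measurable_fun setT (fun t => ip (u t) v).
Proof.
rewrite strongly_measurableE => su; apply: simple_limit_measurable.
exact: (simple_limit_map (ip_continuous ip_norm (y := v)) su).
Qed.

Lemma ip_integrable u v : bochner_integrable u ->
  mu.-integrable setT (EFin \o (fun t => ip (u t) v)).
Proof.
move=> iu; apply: (integrable_le _ (integrableZ `|v| (bochner_norm_integrable iu))).
  by apply: strongly_measurable_ip; case: iu.
by move=> t; rewrite mulrC; exact: ip_cauchy_schwarz.
Qed.

Lemma simple_strongly_measurable (E : normedModType R) (s : R -> E) :
  simple_function s -> strongly_measurable s.
Proof. by move=> ss; exists (fun=> s); split => // t; exact: cvg_cst. Qed.

Lemma simple_integralP s v : simple_function s -> bochner_integrable s ->
  ip (simple_integral s) v = \int[mu]_t ip (s t) v.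
Proof.
move=> [fs ms] is_.
pose X := fset_set (range s).
pose F x t := ip x v * \1_(s @^-1` [set x]) t.
have sF : (fun t => ip (s t) v) = (fun t => \sum_(x <- X) F x t).
  apply/funext => t; rewrite (big_fsetD1 (s t))/=; last first.
    by rewrite in_fset_set//; apply/mem_set; exists t.
  rewrite /F indicE mem_set// mulr1 big1_fset ?addr0// => x.
  rewrite in_fsetD1 => /andP[xs _] _; rewrite indicE memNset ?mulr0//= => st.
  by rewrite st eqxx in xs.
(* The indicator of a fibre over [x != 0] is at most [|s| / |x|]. The fibre over 0 may have infinite
   measure, but its term is zero. *)
have iA x : x != 0 -> mu.-integrable setT (EFin \o \1_(s @^-1` [set x])).
  move=> x0.
  apply: (integrable_le _ (integrableZ `|x|^-1 (bochner_norm_integrable is_))).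
    by apply: measurable_indic; exact: ms.
  move=> t; rewrite indicE; have [/set_mem /= ->|_] := boolP (t \in _).
    by rewrite normr1 mulVf// normr_eq0.
  by rewrite normr0 mulr_ge0// invr_ge0.
have F0 : F 0 = cst 0 by apply/funext => t; rewrite /F ip0l mul0r.
have iF x : mu.-integrable setT (EFin \o F x).
  have [->|x0] := eqVneq x 0; last exact: integrableZ (iA _ x0).
  by rewrite F0; exact: integrable0.
rewrite sF (Rintegral_sum _ iF).2 /simple_integral fsbig_finite//=.
rewrite (big_morph (ip^~ v) (fun x y => ipDl ip x y v) (ip0l ip v)).
apply: eq_bigr => x _; rewrite ipZl; have [->|x0] := eqVneq x 0.
  by rewrite ip0l mulr0 F0 Rintegral_cst// mul0r.
rewrite /F RintegralZl//; last exact: iA.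
rewrite mulrC /Rintegral integral_indic//; last exact: ms.
by congr (_ * fine (mu _)); rewrite setIT.
Qed.

(** Pairing [w] with itself gives [|w|^2 <= |w| * \int g]. Only the pairings of [w] are assumed, so
    the bound serves integrals of simple functions as well as their limits. *)
Lemma Rintegral_norm_le w u (g : R -> R) :
  bochner_integrable u -> mu.-integrable setT (EFin \o g) ->
  (forall t, `|u t| <= g t) ->
  (forall v, ip w v = \int[mu]_t ip (u t) v) -> `|w| <= \int[mu]_t g t.
Proof.
move=> iu ig ug wu.
have ww : `|w| * `|w| <= (\int[mu]_t g t) * `|w|.
  rewrite -expr2 -ip_norm wu -RintegralZr//.
  apply: le_Rintegral => //; first exact: ip_integrable.
    by under eq_fun do rewrite mulrC; exact: integrableZ.
  move=> t _; rewrite (le_trans (ler_norm _))//.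
  by rewrite (le_trans (ip_cauchy_schwarz ip_norm _ _))// ler_wpM2r.
have [w0|w0] := eqVneq w 0; last by move: ww; rewrite ler_pM2r ?normr_gt0.
by rewrite w0 normr0 Rintegral_ge0// => t _; exact: le_trans (ug t).
Qed.

Lemma strongly_measurableB (E : normedModType R) (u v : R -> E) :
  strongly_measurable u -> strongly_measurable v ->
  strongly_measurable (fun t => u t - v t).
Proof.
rewrite !strongly_measurableE => su sv.
apply: (simple_limit_map2 (h := fun z : E * E => z.1 - z.2) _ su sv).
by move=> z; apply: cvgB; [exact: cvg_fst|exact: cvg_snd].
Qed.

Lemma bochner_integrableB (E : normedModType R) (u v : R -> E) :
  bochner_integrable u -> bochner_integrable v ->
  bochner_integrable (fun t => u t - v t).
Proof.
move=> iu iv; apply: (bochner_integrable_le _ (integrable_add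
  (bochner_norm_integrable iu) (bochner_norm_integrable iv))).
  by apply: strongly_measurableB; [case: iu|case: iv].
by move=> t; exact: ler_normB.
Qed.

Lemma Rintegral_cvg0 (F : nat -> R -> R) :
  (\int[mu]_t (F n t)%:E)%E @[n --> \oo] --> 0%E ->
  \int[mu]_t F n t @[n --> \oo] --> 0.
Proof. by move/fine_cvgP => []. Qed.

Lemma Rintegral_ip_dist u s v : bochner_integrable u -> bochner_integrable s ->
  `|\int[mu]_t ip (u t) v - \int[mu]_t ip (s t) v| <=
  (\int[mu]_t `|u t - s t|) * `|v|.
Proof.
move=> iu is_; have ius := bochner_integrableB iu is_.
have iB := ip_integrable v ius.
rewrite -RintegralB//; try exact: ip_integrable.
rewrite (_ : \int[mu]_t (ip (u t) v - ip (s t) v) =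
  \int[mu]_t ip (u t - s t) v); last by apply: eq_Rintegral => t _; rewrite ipBl.
rewrite (le_trans (le_normr_Rintegral _ iB))// -RintegralZr//; last first.
  exact: bochner_norm_integrable.
apply: le_Rintegral => //.
- apply: (integrable_le _ (integrableZ `|v| (bochner_norm_integrable ius))).
    apply: (measurableT_comp (@normr_measurable R setT)).
    by apply: strongly_measurable_ip; case: ius.
  by move=> t; rewrite normr_id mulrC ip_cauchy_schwarz.
- by under eq_fun do rewrite mulrC; exact: integrableZ (bochner_norm_integrable ius).
- by move=> t _; exact: ip_cauchy_schwarz.
Qed.

(** The numbers [ip (simple_integral (s n)) v] tend to the left side by continuity of [ip] and to
    the right side by convergence in L1. Hence [w] does not depend on the approximating sequence. *)
Lemma is_bochner_integralP u w v : bochner_integrable u ->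
  is_bochner_integral u w -> ip w v = \int[mu]_t ip (u t) v.
Proof.
move=> iu [_ [s [ss us sw]]].
have lim1 : ip (simple_integral (s n)) v @[n --> \oo] --> ip w v.
  by apply: (cvg_comp (fun n => simple_integral (s n)) (ip^~ v) sw);
    exact: ip_continuous.
apply: (cvg_unique _ lim1) => //.
apply/cvgrPdist_lt => e e0.
have v0 : 0 < `|v| + 1 by rewrite ltr_pwDr.
near=> n; have [sn isn] := ss n.
rewrite simple_integralP// (le_lt_trans (Rintegral_ip_dist _ iu isn))//.
have I0 : 0 <= \int[mu]_t `|u t - s n t| by exact: Rintegral_ge0.
rewrite (@le_lt_trans _ _ ((\int[mu]_t `|u t - s n t|) * (`|v| + 1)))//.
  by rewrite ler_wpM2l// lerDl.
rewrite -ltr_pdivlMr// -[X in X < _]ger0_norm//.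
near: n; apply: (cvgr0_norm_lt _ (Rintegral_cvg0 us)); exact: divr_gt0.
Unshelve. all: by end_near. Qed.

(* Truncating the simple approximations of [u] at [2 |u|] makes them dominated
   by [u] without increasing their distance to [u]. *)
Let truncated u s t := if `|s t| <= 2 * `|u t| then s t else 0.

Let truncated_simple u s : strongly_measurable u -> simple_function s ->
  simple_function (truncated u s).
Proof.
move=> su ss.
pose b t := `|s t| <= 2 * `|u t|.
have mb : measurable_fun setT b.
  apply: measurable_fun_ler.
    by apply: strongly_measurable_norm; exact: simple_strongly_measurable.
  by apply: measurable_funM => //; exact: strongly_measurable_norm.
have sb : @simple_map _ (measurableTypeR R) _ b.
  split; first exact: finite_finset.
  by move=> c; rewrite -[X in measurable X]setTI; apply: mb.
exact: (simple_map_comp (fun z : H * bool => if z.2 then z.1 else 0)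
  (simple_map_pair (ss : @simple_map _ (measurableTypeR R) _ s) sb)).
Qed.

Let truncated_norm u s t : `|truncated u s t| <= 2 * `|u t|.
Proof. by rewrite /truncated; case: ifP => // _; rewrite normr0 mulr_ge0. Qed.

Let truncated_dist u s t : `|u t - truncated u s t| <= `|u t - s t|.
Proof.
rewrite /truncated; case: ifPn => //; rewrite -ltNge subr0 => h.
have := lerB_dist (s t) (u t); rewrite (distrC (s t)).
by move: h; set a := `|s t|; set b := `|u t|; set c := `|_ - _| => h h1; lra.
Qed.

(** The truncated approximations lie within [3 |u|] of [u], so dominated convergence yields
    convergence in L1. Their integrals differ by at most the sum of the L1 distances to [u], hence
    form a Cauchy sequence, and [H] is complete. *)
Lemma is_bochner_integral_exists u : bochner_integrable u ->
  exists w, is_bochner_integral u w.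
Proof.
move=> iu; have [su uy] := iu; have [s [ss su_cvg]] := su.
have iN := bochner_norm_integrable iu.
pose r n := truncated u (s n).
have sr n : simple_function (r n) by exact: truncated_simple.
have ir n : bochner_integrable (r n).
  apply: (bochner_integrable_le _ (integrableZ 2 iN)) => [|t].
    exact: simple_strongly_measurable.
  exact: truncated_norm.
have iur n := bochner_integrableB iu (ir n).
have ur0 : (\int[mu]_t (`|u t - r n t|%:E))%E @[n --> \oo] --> 0%E.
  have [] := @dominated_convergence _ _ _ mu setT measurableT
    (fun n t => (`|u t - r n t|)%:E) (cst 0%E) (fun t => (3 * `|u t|)%:E).
  - move=> n; apply/measurable_EFinP; apply: strongly_measurable_norm.
    by case: (iur n).
  - exact: measurable_cst.
  - apply: aeW => t _; apply: cvg_EFin; first exact: nearW.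
    apply: (@squeeze_cvgr _ _ _ _ (cst 0) (fun n => `|u t - s n t|)).
    + apply: nearW => n; rewrite normr_ge0/=; exact: truncated_dist.
    + exact: cvg_cst.
    + rewrite -[X in _ --> X](normr0 H) -(subrr (u t)).
      by apply: cvg_norm; apply: cvgB; [exact: cvg_cst|exact: su_cvg].
  - exact: integrableZ.
  - apply: aeW => t n _ /=; rewrite lee_fin normr_id (le_trans (ler_normB _ _))//.
    have := truncated_norm u (s n) t; rewrite -/(r n) => h; lra.
  move=> _ _; rewrite integral0; apply: cvg_trans; apply: near_eq_cvg.
  exact: nearW.
have R0 := Rintegral_cvg0 ur0.
have I0 n : 0 <= \int[mu]_t `|u t - r n t| by exact: Rintegral_ge0.
have dist n m : `|simple_integral (r n) - simple_integral (r m)| <=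
    \int[mu]_t `|u t - r n t| + \int[mu]_t `|u t - r m t|.
  rewrite -RintegralD//; try exact: bochner_norm_integrable.
  apply: (@Rintegral_norm_le _ (fun t => r n t - r m t)).
  - exact: bochner_integrableB.
  - by apply: integrable_add; exact: bochner_norm_integrable.
  - by move=> t; rewrite (distrC (u t)); exact: ler_distD.
  - move=> v; rewrite ipBl !simple_integralP// -RintegralB//;
      try exact: ip_integrable.
    by apply: eq_Rintegral => t _; rewrite ipBl.
have cI : cvgn (fun n => simple_integral (r n)).
  apply/cauchy_cvgP/cauchyP => e e0.
  have e2 : 0 < e / 2 by rewrite divr_gt0.
  have [N _ hN] := cvgr0_norm_lt _ R0 _ e2.
  exists (simple_integral (r N)); exists N => // n /= Nn.
  rewrite -ball_normE /= (le_lt_trans (dist _ _))// (splitr e) ltrD//.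
    by have := hN N (leqnn N); rewrite /= ger0_norm.
  by have := hN n Nn; rewrite /= ger0_norm.
exists (limn (fun n => simple_integral (r n))); split => //.
by exists r; split.
Qed.

(** Existence rules out the default value of [xget], and the identity then determines the
    integral. *)
Lemma bochner_integralP u v : bochner_integrable u ->
  ip (bochner_integral u) v = \int[mu]_t ip (u t) v.
Proof.
move=> iu; apply: is_bochner_integralP => //.
have [w uw] := is_bochner_integral_exists iu.
exact: (@xgetPex _ 0 (is_bochner_integral u) (ex_intro _ w uw)).
Qed.

Lemma norm_bochner_integral_le u (g : R -> R) : bochner_integrable u ->
  mu.-integrable setT (EFin \o g) -> (forall t, `|u t| <= g t) ->
  `|bochner_integral u| <= \int[mu]_t g t.
Proof.
move=> iu ig ug; apply: (Rintegral_norm_le iu ig ug) => v.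
exact: bochner_integralP.
Qed.

Lemma bochner_integral_unique u w : bochner_integrable u ->
  (forall v, ip w v = \int[mu]_t ip (u t) v) -> bochner_integral u = w.
Proof.
by move=> iu uw; apply: (ip_ext ip_norm) => v; rewrite bochner_integralP.
Qed.

Lemma bochner_integrableZ (E : normedModType R) (u : R -> E) k :
  bochner_integrable u -> bochner_integrable (fun t => k *: u t).
Proof.
move=> iu; apply: (bochner_integrable_le _
  (integrableZ `|k| (bochner_norm_integrable iu))).
  case: iu; rewrite !strongly_measurableE => su _.
  exact: (simple_limit_map (h := fun x : E => k *: x) (@scaler_continuous _ _ k) su).
by move=> t; rewrite normrZ.
Qed.

Lemma bochner_integralB u s : bochner_integrable u -> bochner_integrable s ->
  bochner_integral (fun t => u t - s t) = bochner_integral u - bochner_integral s.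
Proof.
move=> iu is_; apply: bochner_integral_unique => [|v].
  exact: bochner_integrableB.
apply: (etrans (ipBl ip (bochner_integral u) (bochner_integral s) v)).
apply: (etrans (congr2 (fun x y => x - y)
  (bochner_integralP v iu) (bochner_integralP v is_))).
rewrite -(RintegralB measurableT (ip_integrable v iu) (ip_integrable v is_)).
by apply: eq_Rintegral => t _; rewrite ipBl.
Qed.

Lemma bochner_integralZ u k : bochner_integrable u ->
  bochner_integral (fun t => k *: u t) = k *: bochner_integral u.
Proof.
move=> iu; apply: bochner_integral_unique => [|v].
  exact: bochner_integrableZ.
rewrite ipZl bochner_integralP// -RintegralZl//; last exact: ip_integrable.
by apply: eq_Rintegral => t _; rewrite ipZl.
Qed.

End Bochner.

(** * Invariance of Lebesgue measure under reflections *)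

Section Reflection.
Context {R : realType}.
Local Notation mu := (@lebesgue_measure R).

Lemma measurable_reflect (t : R) :
  measurable_fun setT (fun s : measurableTypeR R => t - s : measurableTypeR R).
Proof. by apply: measurable_funB => //; exact: measurable_cst. Qed.

(** A measure with the right value on half-open intervals is Lebesgue measure; reflection moves the
    closed end to the other side and keeps the length. *)
Lemma lebesgue_measure_reflect (t : R) (A : set R) : measurable A ->
  pushforward mu (fun s : measurableTypeR R => t - s : measurableTypeR R) A = mu A.
Proof.
move=> mA.
pose phi : {mfun measurableTypeR R >-> measurableTypeR R} :=
  HB.pack (fun s : measurableTypeR R => t - s : measurableTypeR R)
    (isMeasurableFun.Build _ _ _ _ _ (measurable_reflect t)).
apply/esym; apply: (lebesgue_measure_unique (mu := pushforward mu phi)) => //=.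
move=> _ [[a b]] _ <-.
rewrite /pushforward.
rewrite (_ : _ @^-1` _ = `[t - b, t - a[%classic); last first.
  apply/seteqP; split => s /=; rewrite !in_itv/= => /andP[h1 h2].
    by rewrite lerBlDr -lerBlDl h2 ltrBrDr -ltrBrDl h1.
  by rewrite ltrBrDr -ltrBrDl h2 lerBlDl -lerBlDr h1.
rewrite !lebesgue_measure_itv/= !lte_fin ltrD2l ltrN2.
by case: ifP => // _; rewrite -!EFinD; congr (_%:E); ring.
Qed.

Lemma ge0_integral_reflect (t : R) (f : R -> \bar R) :
  measurable_fun setT f -> (forall s, 0 <= f s)%E ->
  (\int[mu]_s f (t - s)%R = \int[mu]_s f s)%E.
Proof.
move=> mf f0.
have := @ge0_integral_pushforward _ _ _ _ R _ (measurable_reflect t) mu setT f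
  measurableT mf (fun s _ => f0 s).
rewrite preimage_setT => <-.
apply: eq_measure_integral; first exact: measurable_reflect.
by move=> ? A mA _; exact: lebesgue_measure_reflect.
Qed.

Lemma integrable_reflect (t : R) (f : R -> R) :
  mu.-integrable setT (EFin \o f) ->
  mu.-integrable setT (EFin \o (fun s => f (t - s))).
Proof.
move=> /integrableP[mf fy]; have mf' := (measurable_EFinP _ _).1 mf.
apply/integrableP; split.
  by apply/measurable_EFinP; apply: (measurableT_comp mf'); exact: measurable_reflect.
rewrite (@ge0_integral_reflect t (fun s => `|(f s)%:E|)%E)//.
by apply: measurableT_comp.
Qed.

Lemma Rintegral_reflect (t : R) (f : R -> R) :
  mu.-integrable setT (EFin \o f) ->
  \int[mu]_s f (t - s) = \int[mu]_s f s.
Proof.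
move=> fi; congr fine.
have mf := measurable_int _ fi.
have := @integral_pushforward _ _ _ _ R _ (measurable_reflect t) mu setT
  (EFin \o f) mf.
rewrite preimage_setT => /(_ (integrable_reflect t fi) measurableT) <-.
apply: eq_measure_integral; first exact: measurable_reflect.
by move=> ? A mA _; exact: lebesgue_measure_reflect.
Qed.

End Reflection.

(** * Convolution with a test function *)

Section Windows.
Context {R : realType} {H : completeNormedModType R} (ip : {dot H for idfun}).
Hypothesis ip_norm : induces_norm ip.
Local Notation mu := (@lebesgue_measure R).
Implicit Types (u : R -> H) (k : R -> R).

(** The indicator keeps all integrals over the whole line, where integrands on different windows are
    compared pointwise. *)
Definition window_energy u (a b : R) : R :=
  \int[mu]_s (`|u s| ^+ 2 * \1_(`[a, b]) s).

Lemma window_energy_ge0 u a b : 0 <= window_energy u a b.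
Proof.
by apply: Rintegral_ge0 => s _; rewrite mulr_ge0 ?sqr_ge0// indicE.
Qed.

Lemma measurable_energy u : strongly_measurable u ->
  measurable_fun setT (fun s => `|u s| ^+ 2).
Proof. by move=> su; apply: measurable_funX; exact: strongly_measurable_norm. Qed.

Lemma integrable_indic_energy u (D : set R) : strongly_measurable u ->
  measurable D -> (\int[mu]_(s in D) (`|u s| ^+ 2)%:E < +oo)%E ->
  mu.-integrable setT (EFin \o (fun s => `|u s| ^+ 2 * \1_D s)).
Proof.
move=> su mD uy; apply: integrable_lty.
- by apply: measurable_funM; [exact: measurable_energy|exact: measurable_indic].
- by move=> s; rewrite mulr_ge0 ?sqr_ge0// indicE.
- move: uy; congr (_ < _)%E; rewrite [LHS]integral_mkcond.
  apply: eq_integral => s _; rewrite patchE indicE.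
  by case: ifP => _; rewrite ?mulr1 ?mulr0.
Qed.

Lemma integrable_window_energy u a b : L2loc u ->
  mu.-integrable setT (EFin \o (fun s => `|u s| ^+ 2 * \1_(`[a, b]) s)).
Proof. by move=> [su uy]; apply: integrable_indic_energy. Qed.

Lemma integrable_window (a b : R) :
  mu.-integrable setT (EFin \o \1_(`[a, b]%classic : set R)).
Proof. exact: integrable_indic_itv. Qed.

Lemma strongly_measurable_scale k u : measurable_fun setT k ->
  strongly_measurable u -> strongly_measurable (fun s => k s *: u s).
Proof.
rewrite !strongly_measurableE => mk su.
apply: (simple_limit_map2 (h := fun z : R^o * H => z.1 *: z.2) _ _ su).
  exact: scale_continuous.
exact: measurable_simple_limit.
Qed.

Section WindowBounds.
Variables (k : R -> R) (u : R -> H) (M a b : R).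
Hypotheses (mk : measurable_fun setT k) (M0 : 0 <= M) (ab : a < b).
Hypothesis kM : forall s, `|k s| <= M * \1_(`[a, b]) s.
Hypothesis u_L2loc : L2loc u.

(** Majorant of [|k u|] from [x <= (l + x^2 / l) / 2]. It is integrable for every [l > 0], and the
    free parameter [l] later yields Cauchy-Schwarz on the window. *)
Let g (l : R) s :=
  M / 2 * (l * \1_(`[a, b]) s + l^-1 * (`|u s| ^+ 2 * \1_(`[a, b]) s)).

Let ig l : mu.-integrable setT (EFin \o g l).
Proof.
apply: integrableZ; apply: integrable_add; apply: integrableZ.
  exact: integrable_window.
exact: integrable_window_energy.
Qed.

Let amgm (l x : R) : 0 < l -> x <= 2^-1 * (l + l^-1 * x ^+ 2).
Proof.
move=> l0; have -> : 2^-1 * (l + l^-1 * x ^+ 2) = (l ^+ 2 + x ^+ 2) / (2 * l).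
  by field; exact: lt0r_neq0.
rewrite ler_pdivlMr ?mulr_gt0//; have := sqr_ge0 (l - x); nra.
Qed.

Let kg l s : 0 < l -> `|k s *: u s| <= g l s.
Proof.
move=> l0; rewrite normrZ /g.
apply: (@le_trans _ _ (M * \1_(`[a, b]) s * `|u s|)); first exact: ler_wpM2r.
rewrite -!mulrA; apply: ler_wpM2l => //; rewrite indicE.
case: (s \in _); rewrite ?mulr1 ?mul1r ?mulr0 ?mul0r ?addr0 ?mulr0//.
exact: amgm.
Qed.

Lemma weighted_integrable : bochner_integrable (fun s => k s *: u s).
Proof.
apply: (bochner_integrable_le _ (ig 1)); last by move=> s; exact: kg.
by apply: strongly_measurable_scale => //; case: u_L2loc.
Qed.

Let Rintegral_window : \int[mu]_s \1_(`[a, b]) s = b - a.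
Proof.
rewrite /Rintegral integral_indic// setIT /= (@lebesgue_measure_itv _ `[a, b]) /=.
by rewrite lte_fin ab -EFinD.
Qed.

Let Rintegral_g l : \int[mu]_s g l s =
  M / 2 * (l * (b - a) + l^-1 * window_energy u a b).
Proof.
have iW := integrable_window a b.
have iE := integrable_window_energy a b u_L2loc.
rewrite /g RintegralZl//; last by apply: integrable_add; exact: integrableZ.
by rewrite RintegralD ?RintegralZl ?Rintegral_window//; exact: integrableZ.
Qed.

Let weighted_norm_le l : 0 < l ->
  `|bochner_integral (fun s => k s *: u s)| <=
  M / 2 * (l * (b - a) + l^-1 * window_energy u a b).
Proof.
move=> l0; rewrite -Rintegral_g.
by apply: (norm_bochner_integral_le ip_norm weighted_integrable (ig l)) => s; exact: kg.
Qed.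

Let half_bound : M / 2 * (1 * (b - a) + 1^-1 * window_energy u a b) <=
  M * ((b - a) + window_energy u a b).
Proof.
rewrite mul1r invr1 mul1r.
rewrite ler_wpM2r//; first by rewrite addr_ge0 ?window_energy_ge0// subr_ge0 ltW.
by rewrite ler_pdivrMr// ler_peMr// ler1n.
Qed.

Lemma weighted_L1_bound : \int[mu]_s `|k s *: u s| <=
  M * ((b - a) + window_energy u a b).
Proof.
apply: le_trans half_bound; rewrite -Rintegral_g.
apply: le_Rintegral => //; first exact/bochner_norm_integrable/weighted_integrable.
by move=> s _; exact: kg.
Qed.

Lemma weighted_norm_bound : `|bochner_integral (fun s => k s *: u s)| <=
  M * ((b - a) + window_energy u a b).
Proof.
exact: le_trans (weighted_norm_le ltr01) half_bound.
Qed.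

Lemma weighted_cauchy_schwarz : 0 < M ->
  `|bochner_integral (fun s => k s *: u s)| ^+ 2 <=
  M ^+ 2 * (b - a) * window_energy u a b.
Proof.
move=> M_gt0; have := weighted_norm_le.
set N := `| _ |; set E := window_energy u a b; set d := b - a => NE.
have d0 : 0 < d by rewrite subr_gt0.
have E0 : 0 <= E by exact: window_energy_ge0.
have := normr_ge0 (bochner_integral (fun s => k s *: u s)).
rewrite -/N le_eqVlt => /predU1P[<-|N0].
  by rewrite expr0n /= !mulr_ge0// ?sqr_ge0// ltW.
(* For this [l] the bound reads [N <= (N^2 + M^2 d E) / (2 N)], that is [N^2 <= M^2 d E]. It is
   positive because the case [N = 0] has been set apart. *)
have := NE (N / (M * d)); rewrite !divr_gt0 ?mulr_gt0// => /(_ isT).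
have -> : M / 2 * (N / (M * d) * d + (N / (M * d))^-1 * E) =
    (N ^+ 2 + M ^+ 2 * d * E) / (2 * N).
  by field; rewrite !lt0r_neq0.
rewrite ler_pdivlMr ?mulr_gt0// => h; nra.
Qed.

End WindowBounds.

Definition past_energy u (T : R) : R :=
  \int[mu]_s (`|u s| ^+ 2 * \1_(`]-oo, T]) s).

Lemma past_energy_ge0 u T : 0 <= past_energy u T.
Proof.
by apply: Rintegral_ge0 => s _; rewrite mulr_ge0 ?sqr_ge0// indicE.
Qed.

Lemma integrable_past_energy u T : L2plus u ->
  mu.-integrable setT (EFin \o (fun s => `|u s| ^+ 2 * \1_(`]-oo, T]) s)).
Proof. by move=> [[su _] uy]; apply: integrable_indic_energy. Qed.

Lemma window_energy_past u a b T : L2plus u -> b <= T ->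
  window_energy u a b <= past_energy u T.
Proof.
move=> up bT; apply: le_Rintegral => //.
- by apply: integrable_window_energy; case: up.
- exact: integrable_past_energy.
- move=> s _; rewrite ler_wpM2l ?sqr_ge0// !indicE.
  have [/set_mem|_] := boolP (s \in `[a, b]%classic); last by rewrite ler0n.
  rewrite /= in_itv/= => /andP[_ sb]; rewrite mem_set//= in_itv/=.
  exact: le_trans bT.
Qed.

End Windows.

Section Convolution.
Context {R : realType} {H : completeNormedModType R} (ip : {dot H for idfun}).
Hypothesis ip_norm : induces_norm ip.
Local Notation mu := (@lebesgue_measure R).
Implicit Types (u : R -> H) (eta : R -> R^o).

Lemma test_function_window eta : test_function eta ->
  exists c M : R, [/\ 0 < c, 0 < M & forall x, `|eta x| <= M * \1_(`[- c, c]) x].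
Proof.
move=> te; have [c [c0 ce]] := test_function_vanish te.
have [M [M0 eM]] := test_function_bounded te.
exists c, M; split => // x; rewrite indicE; have [xc|xc] := boolP (x \in _).
  by rewrite mulr1.
rewrite ce ?normr0 ?mulr0// ltNge; apply: contraNN xc => xc.
by rewrite inE /= in_itv/= -ler_norml.
Qed.

Lemma indic_window_sub (c t s : R) :
  \1_(`[- c, c]) (t - s) = \1_(`[t - c, t + c]) s :> R.
Proof.
rewrite !indicE; congr (_%:R); congr nat_of_bool; apply/idP/idP;
  rewrite !inE /= !in_itv/= => /andP[h1 h2]; apply/andP; split; lra.
Qed.

Lemma continuous_reflect eta (t : R) : continuous eta ->
  measurable_fun setT (fun s : R => eta (t - s)).
Proof.
move=> ce; apply: continuous_measurable_fun => s.
apply: (@continuous_comp R R R (fun s => t - s) eta); last exact: ce.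
by apply: cvgB; [exact: cvg_cst|exact: cvg_id].
Qed.

Lemma test_function_measurable eta (t : R) : test_function eta ->
  measurable_fun setT (fun s : R => eta (t - s)).
Proof. by move=> te; apply: continuous_reflect; exact: smooth_continuous te.1. Qed.

Lemma convolution_integrable eta u t : test_function eta -> L2loc u ->
  bochner_integrable (fun s => eta (t - s) *: u s).
Proof.
move=> te lu; have [c [M [c0 M0 eM]]] := test_function_window te.
apply: (weighted_integrable (M := M) (a := t - c) (b := t + c)) => //.
- exact: test_function_measurable.
- exact: ltW.
- by move=> s; rewrite -indic_window_sub.
Qed.

(** [c] and [M] depend on [eta] alone; this uniformity in [t] lets the bound be integrated over a
    half-line. The factor [2 * c] is the width of the window. *)
Lemma convolution_bound eta : test_function eta ->
  exists c M : R, [/\ 0 < c, 0 < M & forall u t, L2loc u ->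
    `|convolution eta u t| ^+ 2 <= M * window_energy u (t - c) (t + c)].
Proof.
move=> te; have [c [M [c0 M0 eM]]] := test_function_window te.
exists c, (M ^+ 2 * (2 * c)); split => //; first by rewrite !mulr_gt0 ?exprn_gt0.
move=> u t lu.
have tc : t - c < t + c by lra.
have := weighted_cauchy_schwarz ip_norm (test_function_measurable t te) (ltW M0) tc
  _ lu M0.
have -> : t + c - (t - c) = 2 * c by ring.
by apply => s; rewrite -indic_window_sub.
Qed.

Lemma convolution_remainder eta : test_function eta ->
  exists c M : R, [/\ 0 < c, 0 < M & forall u t h, L2loc u -> `|h| <= 1 ->
    `|convolution eta u (t + h) - convolution eta u t
      - h *: convolution (derive1 eta) u t| <=
    M * (2 * c + window_energy u (t - c) (t + c)) * h ^+ 2].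
Proof.
move=> te; have te1 := test_function_derive1 te.
have [M [M0 eM]] := test_function_remainder te.
have [c [c0 ce]] := test_function_vanish te.
have ce1 := derive1_vanish ce.
(* For [|h| <= 1] the three kernels centred at [t + h] and [t] all vanish outside the window of
   radius [c + 1] around [t], so they combine into a single kernel of size [M h^2]. *)
pose d := c + 1; have d0 : 0 < d by rewrite addr_gt0.
exists d, M; split => //.
move=> u t h lu h1.
pose k s := eta (t + h - s) - eta (t - s) - h * derive1 eta (t - s).
have -> : convolution eta u (t + h) - convolution eta u t
      - h *: convolution (derive1 eta) u t = bochner_integral (fun s => k s *: u s).
  have i1 := convolution_integrable (t + h) te lu.
  have i2 := convolution_integrable t te lu.
  have i3 := convolution_integrable t te1 lu.
  rewrite /convolution -(bochner_integralB ip_norm i1 i2).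
  rewrite -(bochner_integralZ ip_norm h i3).
  rewrite -(bochner_integralB ip_norm (bochner_integrableB i1 i2)
    (bochner_integrableZ h i3)).
  by congr bochner_integral; apply/funext => s; rewrite /k !scalerBl scalerA.
have mk : measurable_fun setT k.
  apply: measurable_funB; first apply: measurable_funB.
  - exact: test_function_measurable.
  - exact: test_function_measurable.
  - by apply: measurable_funM => //; exact: test_function_measurable.
have td : t - d < t + d by lra.
have Mh0 : 0 <= M * h ^+ 2 by rewrite mulr_ge0 ?sqr_ge0// ltW.
have kM x : `|k x| <= M * h ^+ 2 * \1_(`[t - d, t + d]) x.
  rewrite indicE; have [_|xd] := boolP (x \in _).
    rewrite mulr1 /k (_ : t + h - x = t - x + h); first exact: eM.
    by rewrite addrAC.
  have {}xd : d < `|t - x|.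
    rewrite ltNge; apply: contraNN xd => xd; rewrite inE /= in_itv/=.
    by move: xd; rewrite ler_norml => /andP[x1 x2]; apply/andP; split; lra.
  rewrite /k !ce ?ce1 ?mulr0 ?subr0 ?normr0 ?mulr0//.
  - by rewrite (le_lt_trans _ xd)// /d; lra.
  - by rewrite (le_lt_trans _ xd)// /d; lra.
  - have := ler_normB (t + h - x) h; rewrite (_ : t + h - x - h = t - x); last by ring.
    by move: xd h1; rewrite /d => xd h1 h2; lra.
rewrite (le_trans (weighted_norm_bound ip_norm mk Mh0 td kM lu))//.
by rewrite (_ : t + d - (t - d) = 2 * d) 1?mulrAC//; ring.
Qed.

Lemma convolution_derive eta u (t : R) : test_function eta -> L2loc u ->
  is_derive t 1 (convolution eta u) (convolution (derive1 eta) u t).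
Proof.
move=> te lu; have [c [M [c0 M0 hM]]] := convolution_remainder te.
apply: quadratic_remainder_derive => h h1; exact: hM.
Qed.

Lemma convolution_continuous eta u : test_function eta -> L2loc u ->
  continuous (convolution eta u).
Proof.
move=> te lu; apply: derivable_continuous => t.
by have [] := convolution_derive t te lu.
Qed.

Lemma convolution_strongly_measurable eta u : test_function eta -> L2loc u ->
  strongly_measurable (convolution eta u).
Proof.
by move=> te lu; exact/strongly_measurable_continuous/convolution_continuous.
Qed.

Lemma convolution_derive1 eta u : test_function eta -> L2loc u ->
  derive1 (convolution eta u) = convolution (derive1 eta) u.
Proof.
move=> te lu; apply/funext => t; apply: is_derive_derive1.
exact: convolution_derive.
Qed.

Lemma convolution_C1 eta u : test_function eta -> L2loc u ->
  C1 (convolution eta u).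
Proof.
move=> te lu; split=> [t|]; first by have [] := convolution_derive t te lu.
rewrite convolution_derive1//; apply: convolution_continuous => //.
exact: test_function_derive1.
Qed.

(** Boundedness on half-lines []-oo, T]] is what membership in [L2plus] provides after convolution,
    and all that a causal kernel looks at. *)
Definition past_bounded u :=
  forall T, exists K : R, forall t, t <= T -> `|u t| <= K.

Lemma convolution_past_bounded eta u : test_function eta -> L2plus u ->
  past_bounded (convolution eta u).
Proof.
move=> te up T; have [c [M [c0 M0 hM]]] := convolution_bound te.
(* The [+ 1] avoids a square root: [x^2 <= y] implies [x <= y + 1], since [2 x <= x^2 + 1]. *)
exists (M * past_energy u (T + c) + 1) => t tT.
have := hM u t up.1.
have := window_energy_past (t - c) up (lerD tT (lexx c)).
have := past_energy_ge0 u (T + c).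
set x := `| _ |; set E := window_energy _ _ _; set F := past_energy _ _ => h1 h2 h3.
have h4 : M * E <= M * F by rewrite ler_pM2l.
have := sqr_ge0 (x - 1); nra.
Qed.

(** The norm stands inside the integral: this is the absolute bound that Fubini requires for the
    memory term. *)
Lemma convolution_past_L1 eta u : test_function eta -> L2plus u ->
  forall T, exists K : R, 0 <= K /\
    forall t, t <= T -> \int[mu]_s `|eta (t - s) *: u s| <= K.
Proof.
move=> te up T; have [c [M [c0 M0 eM]]] := test_function_window te.
exists (M * (2 * c + past_energy u (T + c))); split.
  by rewrite mulr_ge0 ?addr_ge0 ?past_energy_ge0 ?mulr_ge0 ?ltW.
move=> t tT.
have tc : t - c < t + c by lra.
have mk := test_function_measurable t te.
rewrite (le_trans (weighted_L1_bound mk (ltW M0) tc _ up.1))//.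
  by move=> s; rewrite -indic_window_sub.
rewrite (_ : t + c - (t - c) = 2 * c); last by ring.
rewrite ler_pM2l// lerD2l.
exact: (window_energy_past (t - c) up (lerD tT (lexx c))).
Qed.

(** One [K] serves all [t <= T], as the memory term integrates this remainder over the entire
    past. *)
Lemma convolution_past_remainder eta u : test_function eta -> L2plus u ->
  forall T, exists K : R, forall t h, t <= T -> `|h| <= 1 ->
    `|convolution eta u (t + h) - convolution eta u t
      - h *: convolution (derive1 eta) u t| <= K * h ^+ 2.
Proof.
move=> te up T; have [c [M [c0 M0 hM]]] := convolution_remainder te.
exists (M * (2 * c + past_energy u (T + c))) => t h tT h1.
rewrite (le_trans (hM u t h up.1 h1))// ler_wpM2r ?sqr_ge0// ler_pM2l// lerD2l.
exact: (window_energy_past (t - c) up (lerD tT (lexx c))).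
Qed.

Lemma integral_window (a b : R) : a < b ->
  (\int[mu]_s (\1_(`[a, b]) s)%:E)%E = (b - a)%:E.
Proof.
move=> ab; rewrite integral_indic// setIT /= (@lebesgue_measure_itv _ `[a, b]) /=.
by rewrite lte_fin ab.
Qed.

(* By Cauchy-Schwarz the integrand is dominated by the energy of [u] over a
   window of fixed width; Tonelli exchanges window and half-line. *)
Lemma convolution_L2plus eta u : test_function eta -> L2plus u ->
  L2plus (convolution eta u).
Proof.
move=> te up; have lu := up.1.
have sU := convolution_strongly_measurable te lu.
have mU := measurable_energy sU.
have past T : (\int[mu]_(t in `]-oo, T]) ((`|convolution eta u t| ^+ 2)%:E) < +oo)%E.
  have [c [M [c0 M0 hM]]] := convolution_bound te.
  (* [T + c] is the farthest point reached by a window centred at [t <= T]. With this cut the double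
     integral stays finite when the half-line in [t] is enlarged to the whole line. *)
  pose f s : R := `|u s| ^+ 2 * \1_(`]-oo, T + c]) s.
  have f0 s : 0 <= f s by rewrite mulr_ge0 ?sqr_ge0// indicE.
  have fi : mu.-integrable setT (EFin \o f) := integrable_past_energy (T + c) up.
  have mf : measurable_fun setT f by apply/measurable_EFinP; case/integrableP: fi.
  pose G (z : measurableTypeR R * measurableTypeR R) : R :=
    f z.2 * \1_(`[- c, c]) (z.1 - z.2).
  have mG : measurable_fun setT G.
    apply: measurable_funM; first exact: (measurableT_comp mf).
    apply: (measurableT_comp (measurable_indic _)) => //.
    by apply: measurable_funB.
  have G0 z : 0 <= G z by rewrite mulr_ge0// indicE.
  have mGt : measurable_fun setT (fun t => \int[mu]_s (G (t, s))%:E)%E.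
    apply: (measurable_fun_fubini_tonelli_F (m2 := mu) (EFin \o G)).
      exact/measurable_EFinP.
    by move=> z; rewrite lee_fin.
  have Gt0 t : (0 <= \int[mu]_s (G (t, s))%:E)%E.
    by apply: integral_ge0 => s _; rewrite lee_fin.
  apply: (@le_lt_trans _ _
      (\int[mu]_(t in `]-oo, T]) (M%:E * \int[mu]_s (G (t, s))%:E))%E).
    apply: ge0_le_integral => //.
    - by apply/measurable_EFinP; exact: measurable_funTS.
    - by apply: measurable_funTS; exact: measurable_funeM.
    - move=> t tT; rewrite (_ : (\int[mu]_s (G (t, s))%:E)%E =
          (window_energy u (t - c) (t + c))%:E); first by rewrite -EFinM lee_fin hM.
      rewrite /window_energy /Rintegral fineK; last first.
        by apply: integrable_fin_num => //; exact: integrable_window_energy.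
      apply: eq_integral => s _; congr (_%:E).
      rewrite /G /f /= indic_window_sub -mulrA; congr (_ * _).
      rewrite !indicE; have [/set_mem/=|_] := boolP (s \in `[t - c, t + c]%classic).
        move: tT; rewrite /= !in_itv/= => tT /andP[_ h]; rewrite mulr1.
        by rewrite mem_set//= in_itv/= (le_trans h)// lerD2r.
      by rewrite mulr0.
  apply: (@le_lt_trans _ _ (\int[mu]_t (M%:E * \int[mu]_s (G (t, s))%:E))%E).
    apply: ge0_subset_integral => //; first exact: measurable_funeM.
    by move=> t _; rewrite mule_ge0// lee_fin ltW.
  rewrite ge0_integralZl//; last by rewrite lee_fin ltW.
  rewrite (fubini_tonelli (EFin \o G)); last 2 first.
  - exact/measurable_EFinP.
  - by move=> z; rewrite lee_fin.
  have -> : (\int[mu]_s \int[mu]_t (EFin \o G) (t, s) =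
      \int[mu]_s ((2 * c) * f s)%:E)%E.
    apply: eq_integral => s _.
    transitivity (\int[mu]_t ((f s)%:E * (\1_(`[s - c, s + c]) t)%:E))%E.
      apply: eq_integral => t _; rewrite -EFinM /G /=; congr (_ * _)%:E.
      rewrite !indicE; congr (_%:R); congr nat_of_bool; apply/idP/idP;
        rewrite !inE /= !in_itv/= => /andP[h1 h2]; apply/andP; split; lra.
    rewrite ge0_integralZl_EFin//; last exact/measurable_EFinP/measurable_indic.
    rewrite integral_window; last by lra.
    by rewrite -EFinM; congr (_%:E); ring.
  have fy : (\int[mu]_s (2 * c * f s)%:E < +oo)%E.
    have /integrableP[_] := integrableZ (2 * c) fi; congr (_ < _)%E.
    by apply: eq_integral => s _; rewrite /= ger0_norm// !mulr_ge0// ltW.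
  by rewrite lte_mul_pinfty// ?lee_fin ?ltW.
split => //; split => // a b.
apply: le_lt_trans (past b); apply: ge0_subset_integral => //.
- exact/measurable_EFinP/measurable_funTS.
- by move=> t; rewrite /= !in_itv/= => /andP[].
Qed.

End Convolution.

(** * The memory term *)

Section Remainders.
Context {R : realType}.

(** [F'] is a candidate derivative. [K] may depend on [t], and the notion is stable under sums and
    bounded operators. *)
Definition quadratic_remainder (E : normedModType R) (F F' : R -> E) (t : R) :=
  exists K : R, forall h, `|h| <= 1 ->
    `|F (t + h) - F t - h *: F' t| <= K * h ^+ 2.

Lemma bounded_opD (E F : normedModType R) (q : bounded_op E F) x y :
  q (x + y) = q x + q y.
Proof. by rewrite -[x in LHS]scale1r bounded_op_linear scale1r. Qed.

Lemma bounded_opB (E F : normedModType R) (q : bounded_op E F) x y :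
  q (x - y) = q x - q y.
Proof. by rewrite bounded_opD -scaleN1r bounded_opZ scaleN1r. Qed.

Lemma quadratic_remainderD (E : normedModType R) (F F' G G' : R -> E) t :
  quadratic_remainder F F' t -> quadratic_remainder G G' t ->
  quadratic_remainder (fun t => F t + G t) (fun t => F' t + G' t) t.
Proof.
move=> [K hK] [L hL]; exists (K + L) => h h1.
have -> : F (t + h) + G (t + h) - (F t + G t) - h *: (F' t + G' t) =
    (F (t + h) - F t - h *: F' t) + (G (t + h) - G t - h *: G' t).
  by rewrite scalerDr !opprD (addrACA (F (t + h))) [LHS]addrACA.
by rewrite (le_trans (ler_normD _ _))// mulrDl lerD ?hK ?hL.
Qed.

Lemma quadratic_remainder_op (E G : normedModType R) (q : bounded_op E G)
    (F F' : R -> E) t : quadratic_remainder F F' t ->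
  quadratic_remainder (fun t => q (F t)) (fun t => q (F' t)) t.
Proof.
move=> [K hK]; exists (op_norm q * K) => h h1.
rewrite -bounded_opZ -!bounded_opB (le_trans (op_norm_ub _ _))// -mulrA.
by rewrite ler_wpM2l ?op_norm_ge0// hK.
Qed.

Lemma quadratic_remainderN (E : normedModType R) (F F' : R -> E) t :
  quadratic_remainder F F' t ->
  quadratic_remainder (fun t => - F t) (fun t => - F' t) t.
Proof.
move=> [K hK]; exists K => h h1.
by rewrite scalerN -!opprD normrN hK.
Qed.

End Remainders.

Section Memory.
Context {R : realType} {H : completeNormedModType R} (ip : {dot H for idfun}).
Hypothesis ip_norm : induces_norm ip.
Local Notation mu := (@lebesgue_measure R).
Variable Q : R -> bounded_op H H.
Hypothesis Q_L1 : bochner_integrable Q.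
Hypothesis Q_causal : forall t, t < 0 -> Q t = 0.
Implicit Types U : R -> H.

Lemma strongly_measurable_reflect (E : normedModType R) (F : R -> E) t :
  strongly_measurable F -> strongly_measurable (fun s => F (t - s)).
Proof.
rewrite !strongly_measurableE => sF.
exact: (simple_limit_precomp (measurable_reflect t) sF).
Qed.

Lemma bochner_integrable_reflect (E : normedModType R) (F : R -> E) t :
  bochner_integrable F -> bochner_integrable (fun s => F (t - s)).
Proof.
move=> iF; apply: (bochner_integrable_le _
  (integrable_reflect t (bochner_norm_integrable iF))) => //.
by apply: strongly_measurable_reflect; case: iF.
Qed.

Lemma bochner_integral_reflect (F : R -> H) t : bochner_integrable F ->
  bochner_integral (fun s => F (t - s)) = bochner_integral F.
Proof.
move=> iF; apply: (bochner_integral_unique ip_norm).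
  exact: bochner_integrable_reflect.
move=> v; rewrite (bochner_integralP ip_norm)//.
by rewrite (Rintegral_reflect t (ip_integrable ip_norm v iF)).
Qed.

Lemma strongly_measurable_apply (G : R -> bounded_op H H) U :
  strongly_measurable G -> strongly_measurable U ->
  strongly_measurable (fun s => G s (U s)).
Proof.
rewrite !strongly_measurableE => sG sU.
exact: (simple_limit_map2 (@continuous_apply _ H H) sG sU).
Qed.

(** For [r < 0] the operator vanishes; for [r >= 0] the argument [t - r] lies in the past of [t]. *)
Lemma memory_kernel_le U t K r : (forall s, s <= t -> `|U s| <= K) ->
  `|Q r (U (t - r))| <= `|Q r| * K.
Proof.
move=> UK; have [r0|r0] := ltP r 0.
  by rewrite Q_causal// !normr0 mul0r.
apply: le_trans (op_norm_ub _ _) _; apply: ler_wpM2l; first exact: op_norm_ge0.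
by apply: UK; rewrite gerBl.
Qed.

Lemma memory_kernel_integrable U t : strongly_measurable U -> past_bounded U ->
  bochner_integrable (fun r => Q r (U (t - r))).
Proof.
move=> sU bU; have [K hK] := bU t.
apply: (bochner_integrable_le _ (integrableZ K (bochner_norm_integrable Q_L1))).
  apply: strongly_measurable_apply; first by case: Q_L1.
  exact: strongly_measurable_reflect.
by move=> r; rewrite mulrC; exact: memory_kernel_le.
Qed.

Lemma memory_reflectE U t :
  (fun s => Q (t - s) (U s)) = (fun s => (fun r => Q r (U (t - r))) (t - s)).
Proof. by apply/funext => s; rewrite /= subKr. Qed.

Lemma memory_integrable U t : strongly_measurable U -> past_bounded U ->
  bochner_integrable (fun s => Q (t - s) (U s)).
Proof.
move=> sU bU; rewrite memory_reflectE.
apply: (bochner_integrable_reflect (F := fun r => Q r (U (t - r)))).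
exact: memory_kernel_integrable.
Qed.

(** The substitution [r = t - s] moves the dependence on [t] from [Q] to [U], so that increments in
    [t] fall on the smooth factor. *)
Lemma memoryE U t : strongly_measurable U -> past_bounded U ->
  memory Q U t = bochner_integral (fun r => Q r (U (t - r))).
Proof.
move=> sU bU; rewrite /memory memory_reflectE.
apply: (bochner_integral_reflect (F := fun r => Q r (U (t - r)))).
exact: memory_kernel_integrable.
Qed.

Lemma memory_remainder U U' : strongly_measurable U -> past_bounded U ->
  strongly_measurable U' -> past_bounded U' ->
  (forall T, exists K : R, forall t h, t <= T -> `|h| <= 1 ->
    `|U (t + h) - U t - h *: U' t| <= K * h ^+ 2) ->
  forall t, quadratic_remainder (memory Q U) (memory Q U') t.
Proof.
move=> sU bU sU' bU' UU' t; have [K hK] := UU' t.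
(* The remainder of the memory is the memory of the remainder, taken at times [t - r <= t] where [K]
   applies. *)
exists (\int[mu]_r (K * `|Q r|)) => h h1.
rewrite !memoryE// -(bochner_integralZ ip_norm); last exact: memory_kernel_integrable.
have i1 := memory_kernel_integrable (t + h) sU bU.
have i2 := memory_kernel_integrable t sU bU.
have i3 := bochner_integrableZ h (memory_kernel_integrable t sU' bU').
have i12 := bochner_integrableB i1 i2.
have i123 := bochner_integrableB i12 i3.
rewrite -!(bochner_integralB ip_norm)// -RintegralZr//; last first.
  exact/integrableZ/bochner_norm_integrable.
apply: (norm_bochner_integral_le ip_norm i123) => [|r].
  under eq_fun do rewrite mulrC mulrA.
  exact/integrableZ/bochner_norm_integrable.
rewrite -bounded_opZ -!bounded_opB mulrAC mulrC.
have [r0|r0] := ltP r 0; first by rewrite Q_causal// !normr0 mul0r.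
apply: le_trans (op_norm_ub _ _) _; apply: ler_wpM2l; first exact: op_norm_ge0.
rewrite (_ : t + h - r = t - r + h); last by rewrite addrAC.
by rewrite hK// gerBl.
Qed.

End Memory.

(** * The weak equation tested against convolution kernels *)

Section Fubini.
Context {R : realType}.
Local Notation mu := (@lebesgue_measure R).

(** Integrability of every section, not just almost every one, makes each inner integral finite, so
    that nothing is lost in passing from extended to real integrals. *)
Lemma Rintegral_exchange (g : R -> R -> R) :
  measurable_fun setT (fun z : measurableTypeR R * measurableTypeR R => g z.1 z.2) ->
  (\int[mu]_s \int[mu]_t (`|g s t|)%:E < +oo)%E ->
  (forall s, mu.-integrable setT (EFin \o g s)) ->
  (forall t, mu.-integrable setT (EFin \o g^~ t)) ->
  mu.-integrable setT (EFin \o (fun t => \int[mu]_s g s t)) /\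
  \int[mu]_t \int[mu]_s g s t = \int[mu]_s \int[mu]_t g s t.
Proof.
move=> mg gy ig1 ig2.
pose G (z : measurableTypeR R * measurableTypeR R) := (g z.2 z.1)%:E.
have mG : measurable_fun setT G.
  by apply/measurable_EFinP; exact: (measurableT_comp mg (@measurable_swap _ _ _ _)).
have iG : (mu \x mu)%E.-integrable setT G by apply/integrable21ltyP.
have e1 : EFin \o (fun t => \int[mu]_s g s t) = fubini_F mu G.
  by apply/funext => t; rewrite /= /Rintegral fineK//;
    exact: (integrable_fin_num measurableT (ig2 t)).
have e2 : EFin \o (fun s => \int[mu]_t g s t) = fubini_G mu G.
  by apply/funext => s; rewrite /= /Rintegral fineK//;
    exact: (integrable_fin_num measurableT (ig1 s)).
split; first by rewrite e1; exact: integrable_fubini_F.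
congr fine; transitivity (\int[mu]_t \int[mu]_s G (t, s))%E.
  by apply: eq_integral => t _; exact: (congr1 (@^~ t) e1).
rewrite Fubini//; apply: eq_integral => s _.
exact: (esym (congr1 (@^~ s) e2)).
Qed.

End Fubini.

Section TestVectors.
Context {R : realType} {V : normedModType R}.
Implicit Type eta : R -> R^o.

(** The sign from the chain rule is put on [v]: the derivative keeps the same shape, with [eta'] and
    [- v], and the induction proving smoothness can proceed. *)
Lemma reflected_derive eta (tau t : R) (v : V) : test_function eta ->
  is_derive t 1 (fun t => eta (tau - t) *: v) (derive1 eta (tau - t) *: - v).
Proof.
move=> te; have [M [M0 hM]] := test_function_remainder te.
apply: (@quadratic_remainder_derive _ _ _ _ _ (M * `|v|)) => h h1.
rewrite scalerN scalerN opprK scalerA -scalerBl -scalerDl normrZ mulrAC.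
rewrite ler_wpM2r//.
have := hM (tau - t) (- h); rewrite sqrrN mulNr opprK.
by rewrite (_ : tau - t - h = tau - (t + h))// opprD addrA.
Qed.

Lemma reflected_derive1 eta (tau : R) (v : V) : test_function eta ->
  derive1 (fun t => eta (tau - t) *: v) =
  (fun t => derive1 eta (tau - t) *: - v).
Proof.
by move=> te; apply/funext => t; apply: is_derive_derive1; exact: reflected_derive.
Qed.

Lemma reflected_test_function eta (tau : R) (v : V) : test_function eta ->
  test_function (fun t : R => eta (tau - t) *: v).
Proof.
move=> te; split.
  move=> n; elim: n eta v te => [|n ih] eta v te t.
    by have [] := reflected_derive tau t v te.
  rewrite derive1Sn reflected_derive1//; apply: ih.
  exact: test_function_derive1.
have [c [c0 ce]] := test_function_vanish te.
apply: (@subclosed_compact _ _ `[tau - c, tau + c]); first exact: closed_closure.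
  exact: segment_compact.
rewrite [X in _ `<=` X](closure_id _).1; last exact: interval_closed.
apply: closure_subset => t /= et.
have : `|tau - t| <= c.
  by rewrite leNgt; apply: contraNN et => ct; rewrite ce// scale0r.
by rewrite in_itv/= ler_norml => /andP[h1 h2]; apply/andP; split; lra.
Qed.

End TestVectors.

Section WeakIdentity.
Context {R : realType} {H V : completeNormedModType R} (ip : {dot H for idfun}).
Hypothesis ip_norm : induces_norm ip.
Local Notation mu := (@lebesgue_measure R).
Variable Q : R -> bounded_op H H.
Hypothesis Q_self_adjoint : forall t, self_adjoint ip (Q t).
Hypothesis Q_L1 : bochner_integrable Q.
Hypothesis Q_causal : forall t, t < 0 -> Q t = 0.
Variables (u : R -> H) (eta : R -> R^o).
Hypotheses (u_plus : L2plus u) (eta_test : test_function eta).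

Let U := convolution eta u.

(** The integrand shared by the two forms of the memory term. Integrated in [t] it gives
    [ip (Q (tau - s) (U s)) y], by self-adjointness of [Q (tau - s)]; integrated in [s], the pairing
    of [u t] with the adjoint memory of the test function. *)
Let pairing tau y s t : R := ip (eta (s - t) *: u t) (Q (tau - s) y).

(** Reduces the joint measurability of [pairing] to that of norms of simple limits on the plane. *)
Lemma ip_polarization x y :
  ip x y = 4^-1 * (`|x + y| ^+ 2 - `|x - y| ^+ 2).
Proof.
rewrite -!ip_norm !ipDl !ipDr !ipNl !ipNr (ipC ip y x).
have aux (a b c : R) : b = 4^-1 * (a + b + (b + c) - (a - b + (- b - - c))).
  by field.
exact: aux.
Qed.

Lemma memory_pairing_measurable tau y : measurable_fun setT
  (fun z : measurableTypeR R * measurableTypeR R => pairing tau y z.1 z.2).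
Proof.
pose T := (measurableTypeR R * measurableTypeR R)%type.
have su : simple_limit (fun z : T => u z.2).
  apply: (simple_limit_precomp (T := measurableTypeR R) (g := @snd _ _) (u := u)).
    exact: measurable_snd.
  by case: u_plus.1.
have sQ : simple_limit (fun z : T => Q (tau - z.1)).
  have := strongly_measurable_reflect tau Q_L1.1; rewrite strongly_measurableE.
  apply: (simple_limit_precomp (T := measurableTypeR R) (g := @fst _ _)).
  exact: measurable_fst.
have sQy : simple_limit (fun z : T => Q (tau - z.1) y).
  exact: (simple_limit_map2 (@continuous_apply _ H H) sQ (simple_limit_cst _ y)).
have seta : simple_limit (fun z : T => eta (z.1 - z.2) : R^o).
  apply: measurable_simple_limit; apply: (measurableT_comp (f := eta)).
    by apply: continuous_measurable_fun; exact: smooth_continuous eta_test.1.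
  exact: measurable_funB.
have seu : simple_limit (fun z : T => eta (z.1 - z.2) *: u z.2).
  exact: (simple_limit_map2 (h := fun z : R^o * H => z.1 *: z.2)
    (@scale_continuous _ _) seta su).
have mnorm (F : T -> H) : simple_limit F -> measurable_fun setT (fun z => `|F z| ^+ 2).
  move=> sF; apply: measurable_funX; apply: simple_limit_measurable.
  exact: (simple_limit_map (h := (fun x : H => `|x| : R^o)) (@norm_continuous _ _) sF).
rewrite (_ : (fun z : T => _) = (fun z : T => 4^-1 *
    (`|eta (z.1 - z.2) *: u z.2 + Q (tau - z.1) y| ^+ 2 -
     `|eta (z.1 - z.2) *: u z.2 - Q (tau - z.1) y| ^+ 2))); last first.
  by apply/funext => z; rewrite /pairing ip_polarization.
apply: measurable_funM => //; apply: measurable_funB; apply: mnorm.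
  apply: (simple_limit_map2 (h := fun z : H * H => z.1 + z.2) _ seu sQy).
  by move=> z; apply: cvgD; [exact: cvg_fst|exact: cvg_snd].
apply: (simple_limit_map2 (h := fun z : H * H => z.1 - z.2) _ seu sQy).
by move=> z; apply: cvgB; [exact: cvg_fst|exact: cvg_snd].
Qed.

Lemma memory_pairing_integrable1 tau y s :
  mu.-integrable setT (EFin \o pairing tau y s).
Proof.
apply: (ip_integrable ip_norm).
exact: convolution_integrable eta_test u_plus.1.
Qed.

Lemma memory_pairing_integral1 tau y s :
  \int[mu]_t pairing tau y s t = ip (Q (tau - s) (U s)) y.
Proof.
rewrite Q_self_adjoint (bochner_integralP ip_norm)//.
exact: convolution_integrable eta_test u_plus.1.
Qed.

Lemma memory_pairing_integrable2 tau y t :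
  mu.-integrable setT (EFin \o (pairing tau y)^~ t).
Proof.
have [M [M0 eM]] := test_function_bounded eta_test.
have iQ := integrable_reflect tau (bochner_norm_integrable Q_L1).
have mg := memory_pairing_measurable tau y.
apply: (integrable_le _ (integrableZ (M * `|u t| * `|y|) iQ)).
  apply: (measurableT_comp mg
    (f := fun z : measurableTypeR R * measurableTypeR R => pairing tau y z.1 z.2)
   (g := fun s : measurableTypeR R => (s, t))).
  exact: pair2_measurable.
move=> s; rewrite /pairing (le_trans (ip_cauchy_schwarz ip_norm _ _))//.
rewrite -mulrA; apply: ler_pM => //.
  by rewrite normrZ ler_wpM2r.
by rewrite mulrC; exact: op_norm_ub.
Qed.

Lemma memory_pairing_integral_lty tau y :
  (\int[mu]_s \int[mu]_t (`|pairing tau y s t|)%:E < +oo)%E.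
Proof.
have [K [K0 hK]] := convolution_past_L1 eta_test u_plus tau.
have iQ := integrable_reflect tau (bochner_norm_integrable Q_L1).
have iKQ := integrableZ (K * `|y|) iQ.
apply: (@le_lt_trans _ _ (\int[mu]_s (K * `|y| * `|Q (tau - s)|)%:E)%E).
  apply: ge0_le_integral => //.
  - by move=> s _; apply: integral_ge0.
  - have mg := memory_pairing_measurable tau y.
    apply: (measurable_fun_fubini_tonelli_F (m2 := mu)
      (fun z : measurableTypeR R * measurableTypeR R =>
        (`|pairing tau y z.1 z.2|)%:E)) => //.
    by apply/measurable_EFinP; exact: measurableT_comp.
  - by case/integrableP: iKQ.
  - move=> s _.
    have iu := convolution_integrable s eta_test u_plus.1.
    have iN := bochner_norm_integrable iu.
    apply: (@le_trans _ _ (\int[mu]_t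
        (`|y| * `|Q (tau - s)| * `|eta (s - t) *: u t|)%:E)%E).
      apply: ge0_le_integral => //.
      + by apply/measurable_EFinP; apply: measurableT_comp => //;
          apply/measurable_EFinP; case/integrableP: (memory_pairing_integrable1 tau y s).
      + by case/integrableP: (integrableZ (`|y| * `|Q (tau - s)|) iN).
      + move=> t _; rewrite lee_fin (le_trans (ip_cauchy_schwarz ip_norm _ _))//.
        by rewrite mulrC ler_wpM2r// mulrC; exact: op_norm_ub.
    rewrite -[leLHS]fineK; last exact/integrable_fin_num/integrableZ.
    rewrite lee_fin -/(Rintegral _ _ _) RintegralZl//.
    (* [K] bounds the inner integral for [s <= tau] only; beyond [tau], causality makes the
       integrand vanish. *)
    have [st|ts] := leP s tau.
      rewrite -[leRHS]mulrA mulrC; apply: ler_wpM2r; first by rewrite mulr_ge0.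
      exact: hK.
    by rewrite Q_causal ?subr_lt0// normr0 !mulr0 mul0r.
by case/integrableP: iKQ => _; congr (_ < _)%E; apply: eq_integral => s _;
  rewrite /= ger0_norm// !mulr_ge0.
Qed.

Lemma memory_duality tau y :
  mu.-integrable setT (EFin \o (fun t => \int[mu]_s pairing tau y s t)) /\
  \int[mu]_t \int[mu]_s pairing tau y s t = ip (memory Q U tau) y.
Proof.
have [i e] := Rintegral_exchange (memory_pairing_measurable tau y)
  (memory_pairing_integral_lty tau y)
  (memory_pairing_integrable1 tau y) (memory_pairing_integrable2 tau y).
have iQU : bochner_integrable (fun s => Q (tau - s) (U s)).
  exact: (memory_integrable Q_L1 Q_causal tau
    (convolution_strongly_measurable ip_norm eta_test u_plus.1)
    (convolution_past_bounded ip_norm eta_test u_plus)).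
split; first exact: i.
rewrite e /memory (bochner_integralP ip_norm y iQU).
by apply: eq_Rintegral => s _; exact: memory_pairing_integral1.
Qed.

(** The reflection [s |-> tau + t - s] exchanges [s - t] and [tau - s], turning [Q (s - t)] with
    weight [eta (tau - s)] into [Q (tau - s)] with weight [eta (s - t)]. *)
Lemma memory_adjoint_duality tau y t :
  ip (u t) (memory_adjoint Q (fun s => eta (tau - s) *: y) t) =
  \int[mu]_s pairing tau y s t.
Proof.
have [M [M0 eM]] := test_function_bounded eta_test.
have sQ : strongly_measurable (fun s => Q (s - t)).
  have -> : (fun s => Q (s - t)) = (fun s => (fun r => Q (0 - r)) (t - s)).
    by apply/funext => s /=; rewrite sub0r opprB.
  apply: (strongly_measurable_reflect (F := fun r => Q (0 - r))).
  by apply: strongly_measurable_reflect; case: Q_L1.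
have iQ : mu.-integrable setT (EFin \o (fun s => `|Q (s - t)|)).
  have := integrable_reflect t (integrable_reflect 0 (bochner_norm_integrable Q_L1)).
  by congr (integrable _ _ _); apply/funext => s /=; rewrite sub0r opprB.
have iF : bochner_integrable (fun s => Q (s - t) (eta (tau - s) *: y)).
  apply: (bochner_integrable_le _ (integrableZ (M * `|y|) iQ)) => [|s].
    apply: strongly_measurable_apply => //.
    apply: strongly_measurable_scale; first exact: test_function_measurable.
    exact: (simple_limit_cst _ y).
  rewrite mulrC (le_trans (op_norm_ub _ _))//.
  rewrite ler_wpM2l ?op_norm_ge0// normrZ.
  by rewrite ler_wpM2r.
rewrite (ipC ip) /memory_adjoint (bochner_integralP ip_norm)//.
rewrite -(Rintegral_reflect (tau + t) (ip_integrable ip_norm (u t) iF)).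
apply: eq_Rintegral => s _; rewrite /pairing.
rewrite (_ : tau + t - s - t = tau - s); last by ring.
rewrite (_ : tau - (tau + t - s) = s - t); last by ring.
by rewrite bounded_opZ !ipZl (ipC ip).
Qed.

End WeakIdentity.

(** * Regularity in V *)

Section Regularity.
Context {R : realType} {H V : completeNormedModType R} (ip : {dot H for idfun}).
Hypothesis ip_norm : induces_norm ip.
Local Notation mu := (@lebesgue_measure R).
Variables (iota : {linear V -> H}) (A B : bounded_op H H) (P : {linear V -> H}).
Variables (Q : R -> bounded_op H H) (f u : R -> H).
Hypothesis A_self_adjoint : self_adjoint ip A.
Hypothesis Q_self_adjoint : forall t, self_adjoint ip (Q t).
Hypothesis Q_L1 : bochner_integrable Q.
Hypothesis Q_causal : forall t, t < 0 -> Q t = 0.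
Hypothesis P_skew_adjoint : skew_adjoint iota ip P.
Hypothesis P_graph_norm : graph_norm_equivalent iota P.
Hypothesis f_L2loc : L2loc f.
Hypothesis u_weak : weak_solution ip iota A P B Q f u.
Implicit Type eta : R -> R^o.

Let u_plus : L2plus u := u_weak.1.

(** The derivative of [eta*u] is written as a convolution with [eta'], so that replacing [eta] by
    [eta'] differentiates all four terms at once. *)
Definition residual eta (t : R) : H :=
  A (convolution (derive1 eta) u t) + B (convolution eta u t)
  + memory Q (convolution eta u) t - convolution eta f t.

Lemma convolution_ip eta (w : R -> H) tau y : test_function eta -> L2loc w ->
  mu.-integrable setT (EFin \o (fun t => eta (tau - t) * ip (w t) y)) /\
  \int[mu]_t (eta (tau - t) * ip (w t) y) = ip (convolution eta w tau) y.
Proof.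
move=> te lw; have iw := convolution_integrable tau te lw.
rewrite /convolution (bochner_integralP ip_norm)//.
have e : (fun t => ip (eta (tau - t) *: w t) y) =
    (fun t => eta (tau - t) * ip (w t) y) by apply/funext => t; rewrite ipZl.
by rewrite -e; split => //; exact: (ip_integrable ip_norm y iw).
Qed.

Lemma weak_equation eta tau (v : V) : test_function eta ->
  ip (convolution eta u tau) (P v) = ip (residual eta tau) (iota v).
Proof.
move=> te; have te1 := test_function_derive1 te.
have [_ /(_ _ (reflected_test_function tau v te))] := u_weak.
rewrite reflected_derive1//.
have fE : \int[mu]_t ip (f t) (iota (eta (tau - t) *: v)) =
    ip (convolution eta f tau) (iota v).
  apply: etrans (convolution_ip tau (iota v) te f_L2loc).2.
  by apply: eq_Rintegral => t _; rewrite linearZ ipZr.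
(* The derivative of the test function is [- eta'(tau - t) v], which gives the [A] term the same
   minus sign as the [B] and memory terms. *)
have uE := Rintegral_sub4
  (convolution_ip tau (P v) te u_plus.1)
  (convolution_ip tau (A (iota v)) te1 u_plus.1)
  (convolution_ip tau (adjoint ip B (iota v)) te u_plus.1)
  (memory_duality ip_norm Q_self_adjoint Q_L1 Q_causal u_plus te tau (iota v)).
move=> /esym weak; apply: (ip_balance
  (A_self_adjoint _ _) (adjointP ip_norm B _ _)).
apply: etrans (etrans (esym weak) (congr1 -%R fE)); apply: etrans (esym uE) _.
apply: eq_Rintegral => t _; apply: esym; rewrite ipBr ipBr ipDr; congr (_ - _).
  have -> : iota (derive1 eta (tau - t) *: - v) =
      (- derive1 eta (tau - t)) *: iota v.
    by rewrite scalerN -scaleNr linearZ.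
  have -> : iota (eta (tau - t) *: v) = eta (tau - t) *: iota v by rewrite linearZ.
  have -> : P (eta (tau - t) *: v) = eta (tau - t) *: P v by rewrite linearZ.
  rewrite bounded_opZ !ipZr mulNr [- _ + _]addrC; congr (_ - _).
  (* [adjoint] is a choice with no linear structure attached; the scalar is extracted by passing to
     [B] and back. *)
  by rewrite -adjointP// ipZr adjointP.
apply: etrans (memory_adjoint_duality ip_norm Q_L1 u te tau (iota v) t).
congr (ip _ (memory_adjoint _ _ _)); apply/funext => s /=.
by rewrite linearZ.
Qed.

(** Gain of regularity: the adjoint graph of [P] is contained in the graph of [- P], so a vector
    known only through its pairings with the range of [P] belongs to the domain. *)
Lemma convolution_range eta tau : test_function eta ->
  exists v : V, iota v = convolution eta u tau /\ - P v = residual eta tau.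
Proof.
move=> te.
have : adjoint_graph iota ip P (convolution eta u tau, residual eta tau).
  by move=> v /=; rewrite (ipC ip) weak_equation// (ipC ip).
by rewrite P_skew_adjoint => -[v _ [vU vz]]; exists v.
Qed.

Lemma convolution_quadratic eta (w : R -> H) t : test_function eta -> L2loc w ->
  quadratic_remainder (convolution eta w) (convolution (derive1 eta) w) t.
Proof.
move=> te lw; have [c [M [c0 M0 hM]]] := convolution_remainder ip_norm te.
by eexists => h h1; exact: hM.
Qed.

Lemma residual_quadratic eta t : test_function eta ->
  quadratic_remainder (residual eta) (residual (derive1 eta)) t.
Proof.
move=> te; have te1 := test_function_derive1 te.
apply: (quadratic_remainderD _ (quadratic_remainderN
  (convolution_quadratic t te f_L2loc))).
apply: quadratic_remainderD; first apply: quadratic_remainderD.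
- exact: (quadratic_remainder_op A (convolution_quadratic t te1 u_plus.1)).
- exact: (quadratic_remainder_op B (convolution_quadratic t te u_plus.1)).
- apply: (memory_remainder ip_norm Q_L1 Q_causal).
  + exact: (convolution_strongly_measurable ip_norm te u_plus.1).
  + exact: (convolution_past_bounded ip_norm).
  + exact: (convolution_strongly_measurable ip_norm te1 u_plus.1).
  + exact: (convolution_past_bounded ip_norm).
  + exact: convolution_past_remainder.
Qed.

(** By [sqrt (a^2 + b^2) <= a + b], an estimate in [V] reduces to two estimates in [H]. *)
Lemma norm_le_graph : exists2 k : R, 0 < k &
  forall v : V, `|v| <= k * (`|iota v| + `|P v|).
Proof.
have [c [C [c0 _ hc]]] := P_graph_norm.
exists c^-1 => [|x]; first by rewrite invr_gt0.
rewrite ler_pdivlMl//; have /andP[h _] := hc x; apply: (le_trans h).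
rewrite /graph_norm -(@ler_pXn2r _ 2) ?nnegrE ?sqrtr_ge0 ?addr_ge0//.
rewrite sqr_sqrtr ?addr_ge0 ?sqr_ge0// sqrrD -addrA lerD2l.
by rewrite lerDr mulrn_wge0// mulr_ge0.
Qed.

(** No continuity of [w] is built in. Recording [P (w t)] along with [iota (w t)] makes the graph
    norm of increments computable by linearity. *)
Definition lifts eta (w : R -> V) :=
  forall t, iota (w t) = convolution eta u t /\ - P (w t) = residual eta t.

Lemma lifts_exists eta : test_function eta -> exists w, lifts eta w.
Proof.
move=> te; have [w hw] := choice (fun t => convolution_range t te).
by exists w.
Qed.

Lemma lifts_derive eta w w' (t : R) : test_function eta ->
  lifts eta w -> lifts (derive1 eta) w' -> is_derive t 1 w (w' t).
Proof.
move=> te hw hw'; have [k k0 hk] := norm_le_graph.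
have [K hK] := convolution_quadratic t te u_plus.1.
have [L hL] := residual_quadratic t te.
apply: (@quadratic_remainder_derive _ _ _ _ _ (k * (K + L))) => h h1.
rewrite -mulrA mulrDl (le_trans (hk _))// ler_pM2l//.
have linE (T : {linear V -> H}) x y z : T (x - y - h *: z) = T x - T y - h *: T z.
  by rewrite !linearB linearZ.
rewrite !linE (hw (t + h)).1 (hw t).1 (hw' t).1; apply: lerD; first exact: hK.
have -> : `|P (w (t + h)) - P (w t) - h *: P (w' t)| =
    `|residual eta (t + h) - residual eta t - h *: residual (derive1 eta) t|.
  rewrite -(hw (t + h)).2 -(hw t).2 -(hw' t).2.
  by rewrite -normrN scalerN !opprD !opprK.
exact: hL.
Qed.

(** The induction is general in [eta] and [w]: the derivative of a lift for [eta] is a lift for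
    [eta'], itself a test function. *)
Lemma lifts_smooth eta w : test_function eta -> lifts eta w -> smooth w.
Proof.
move=> te hw n; elim: n eta w te hw => [|n ih] eta w te hw t.
  have [w' hw'] := lifts_exists (test_function_derive1 te).
  by have [] := lifts_derive t te hw hw'.
have [w' hw'] := lifts_exists (test_function_derive1 te).
rewrite derive1Sn; have -> : derive1 w = w'.
  by apply/funext => s; apply: is_derive_derive1; exact: lifts_derive hw hw'.
exact: (ih _ _ (test_function_derive1 te) hw').
Qed.

Lemma lifts_strong_solution eta w : test_function eta -> lifts eta w ->
  strong_solution iota A P B Q (convolution eta f) (convolution eta u).
Proof.
move=> te hw; split.
- exact: (convolution_C1 ip_norm te u_plus.1).
- exact: (convolution_L2plus ip_norm te u_plus).
exists w; split; first exact/smooth_continuous/(lifts_smooth te hw).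
  by move=> t; case: (hw t).
move=> t; split.
  exact: (memory_integrable Q_L1 Q_causal t
    (convolution_strongly_measurable ip_norm te u_plus.1)
    (convolution_past_bounded ip_norm te u_plus)).
rewrite (convolution_derive1 ip_norm te u_plus.1).
rewrite -[P (w t)]opprK (hw t).2 /residual.
have aux (a b c d : H) : a - (a + b + c - d) + b + c = d.
  by rewrite (addrAC a _ b) (addrAC (a + b) _ c) subKr.
exact: aux.
Qed.

End Regularity.

Theorem proposition1 (R : realType)
  (H : completeNormedModType R) (ipH : {dot H for idfun})
  (ipH_norm : induces_norm ipH) (H_separable : separable H)
  (V : completeNormedModType R) (ipV : {dot V for idfun})
  (ipV_norm : induces_norm ipV) (V_separable : separable V)
  (iota : {linear V -> H}) (iota_inj : injective iota)
  (iota_continuous : continuous iota) (iota_dense : dense (range iota))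
  (A : bounded_op H H) (A_self_adjoint : self_adjoint ipH A)
  (Clo Chi : R) (Clo_gt0 : 0 < Clo) (Clo_le_Chi : Clo <= Chi)
  (A_bounds : forall x, Clo * ipH x x <= ipH (A x) x <= Chi * ipH x x)
  (B : bounded_op H H)
  (Q : R -> bounded_op H H)
  (Q_self_adjoint : forall t, self_adjoint ipH (Q t))
  (Q_L1 : bochner_integrable Q)
  (Q_continuous : {within `[0, +oo[, continuous Q})
  (Q_causal : forall t, t < 0 -> Q t = 0)
  (P : {linear V -> H}) (P_skew_adjoint : skew_adjoint iota ipH P)
  (P_graph_norm : graph_norm_equivalent iota P)
  (f : R -> H) (f_L2loc : L2loc f)
  (u : R -> H) (u_L2loc : L2loc u)
  (u_weak : weak_solution ipH iota A P B Q f u)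
  (eta : R -> R) (eta_test : test_function eta) :
  strong_solution iota A P B Q (convolution eta f) (convolution eta u) /\
  exists w : R -> V,
    (forall t, iota (w t) = convolution eta u t) /\ smooth w.
Proof.
have [w hw] := lifts_exists ipH_norm A_self_adjoint Q_self_adjoint Q_L1 Q_causal
  P_skew_adjoint f_L2loc u_weak eta_test.
split.
  exact: (lifts_strong_solution ipH_norm A_self_adjoint Q_self_adjoint Q_L1
    Q_causal P_skew_adjoint P_graph_norm f_L2loc u_weak eta_test hw).
exists w; split; first by move=> t; case: (hw t).
exact: (lifts_smooth ipH_norm A_self_adjoint Q_self_adjoint Q_L1
    Q_causal P_skew_adjoint P_graph_norm f_L2loc u_weak eta_test hw).
Qed.
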